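(* Let $\Gamma_0$ be the constraint language on $\{0,1\}$ consisting of the ternary relations $\{(x,y,z)\in\{0,1\}^3\mid x=y\text{ or }z=0\}$ and $\{(x,y,z)\in\{0,1\}^3\mid x=y\text{ or }z=1\}$ and the unary relations $\{0\}$ and $\{1\}$. Let $N=\{(a,b,c)\in\{0,1,2\}^{3}\mid \{a,b,c\}\neq\{0,1,2\}\}$. Then $\mathrm{CSP}(\Gamma_0)$ is polynomial-time reducible to $\mathrm{SCSP}(\{N\})$.
   Context: A constraint language on a finite set $A$ is a set $\Gamma$ of relations on $A$. An instance of $\mathrm{CSP}(\Gamma)$ is a formula $R_1(z_{1,1},\dots,z_{1,n_1})\wedge\dots\wedge R_s(z_{s,1},\dots,z_{s,n_s})$ with $R_i\in\Gamma$ and each $z_{i,j}$ among variables $x_1,\dots,x_n$; the question is whether it is satisfiable over $A$. An instance of $\mathrm{SCSP}(\Gamma)$ consists of a fixed finite set of variables $\{x_1,\dots,x_n\}$ (not all of which need occur in constraints) together with such a formula; the question is whether there is a satisfying assignment with $\{x_1,\dots,x_n\}=A$ as a set of values. *)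

(* Defs.v *)
From Stdlib Require Import List Arith NArith.
Import ListNotations.

(* Machine model: multi-stack (register) machine over bits.            *)
(* Registers are indexed by nat, each holds a stack (list bool).       *)
(* A program is a list of instructions; the machine halts as soon as   *)
(* the program counter is outside the program. Each executed           *)
(* instruction costs one step. (Equivalent to multitape Turing         *)
(* machines up to polynomial overhead.)                                *)

Inductive instr : Type :=
  | Push (r : nat) (b : bool)
  | Pop  (r : nat) (if_empty if_false if_true : nat).

Record mstate : Type := MState { pc : nat; regs : nat -> list bool }.

Definition upd (R : nat -> list bool) (r : nat) (l : list bool) : nat -> list bool :=
  fun r' => if Nat.eqb r' r then l else R r'.

Definition exec (i : instr) (s : mstate) : mstate :=
  match i with
  | Push r b => MState (S (pc s)) (upd (regs s) r (b :: regs s r))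
  | Pop r e f t =>
      match regs s r with
      | [] => MState e (regs s)
      | false :: l => MState f (upd (regs s) r l)
      | true :: l => MState t (upd (regs s) r l)
      end
  end.

Fixpoint run (p : list instr) (k : nat) (s : mstate) : option mstate :=
  match nth_error p (pc s) with
  | None => Some s
  | Some i => match k with
              | 0 => None
              | S k' => run p k' (exec i s)
              end
  end.

Definition init (x : list bool) : mstate :=
  MState 0 (fun r => if Nat.eqb r 0 then x else []).

Definition poly_time_computable (f : list bool -> list bool) : Prop :=
  exists (p : list instr) (c d : nat),
    forall x : list bool, exists s : mstate,
      run p (c * length x ^ d + c) (init x) = Some s /\ regs s 1 = f x.

Definition poly_reducible (L1 L2 : list bool -> Prop) : Prop :=
  exists f : list bool -> list bool,
    poly_time_computable f /\ forall x, L1 x <-> L2 (f x).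

Record relation (A : Type) : Type := Rel { arity : nat; holds : list A -> Prop }.
Arguments Rel {A}.
Arguments arity {A}.
Arguments holds {A}.

(* A constraint language is a finite list of relations; a constraint
   refers to a relation by its index in that list. *)
Definition language (A : Type) := list (relation A).

(* An instance: the variables x_0, ..., x_(nvars-1) and a list of constraints
   (relation index, scope). *)
Record instance : Type := Inst { nvars : nat; constrs : list (nat * list nat) }.

Definition wf_instance {A} (G : language A) (I : instance) : Prop :=
  forall c, In c (constrs I) ->
    exists R, nth_error G (fst c) = Some R /\
              length (snd c) = arity R /\
              forall v, In v (snd c) -> v < nvars I.

Definition satisfies {A} (G : language A) (I : instance) (alpha : nat -> A) : Prop :=
  forall c, In c (constrs I) ->
    exists R, nth_error G (fst c) = Some R /\ holds R (map alpha (snd c)).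

(* Encoding of instances as bit strings: the variable count in unary   *)
(* (the variables are listed), numbers inside constraints in           *)
(* self-delimiting binary.                                             *)

Fixpoint enc_pos (p : positive) : list bool :=
  match p with
  | xH => [true; true; false]
  | xO q => true :: false :: enc_pos q
  | xI q => true :: true :: enc_pos q
  end.

Definition enc_nat (n : nat) : list bool :=
  match N.of_nat n with
  | N0 => [false]
  | Npos p => enc_pos p
  end.

Definition enc_constr (c : nat * list nat) : list bool :=
  enc_nat (fst c) ++ enc_nat (length (snd c)) ++ concat (map enc_nat (snd c)).

Definition enc_instance (I : instance) : list bool :=
  repeat true (nvars I) ++ [false] ++ concat (map enc_constr (constrs I)).

Definition CSP {A} (G : language A) (x : list bool) : Prop :=
  exists I, x = enc_instance I /\ wf_instance G I /\
    exists alpha : nat -> A, satisfies G I alpha.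

Definition SCSP {A} (G : language A) (x : list bool) : Prop :=
  exists I, x = enc_instance I /\ wf_instance G I /\
    exists alpha : nat -> A, satisfies G I alpha /\
      forall a : A, exists i, i < nvars I /\ alpha i = a.

Definition ter3 {A} (P : A -> A -> A -> Prop) : list A -> Prop :=
  fun l => match l with [x; y; z] => P x y z | _ => False end.

Definition un1 {A} (P : A -> Prop) : list A -> Prop :=
  fun l => match l with [x] => P x | _ => False end.

Definition Gamma0 : language bool :=
  [ Rel 3 (ter3 (fun x y z => x = y \/ z = false));
    Rel 3 (ter3 (fun x y z => x = y \/ z = true));
    Rel 1 (un1 (fun x => x = false));
    Rel 1 (un1 (fun x => x = true)) ].

Inductive three : Type := t0 | t1 | t2.

(* N = {(a,b,c) | {a,b,c} <> {0,1,2}}; since {a,b,c} is always a subset of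
   {0,1,2}, set equality means every element of {0,1,2} is among a,b,c. *)
Definition Nrel : relation three :=
  Rel 3 (ter3 (fun a b c => ~ (forall d : three, d = a \/ d = b \/ d = c))).

Definition LangN : language three := [Nrel].

(* Main.v *)
(* Each source variable [v] gets three vertices [vx v], [vz v], [vw v], meant to
   be coloured (0,0,2) when [v] is false and (1,2,1) when [v] is true; the
   constants contribute the triples (p0,p0,p2) and (p1,p2,p1), where p0, p1, p2
   are the vertices 0, 1, 2. For any two triples (x,z,w), (x',z',w') one imposes
   N on (p0,x,x'), (p0,z,z'), (p1,w,w'), (x,z,w') and (x,w,z'). If a surjective
   colouring gave p0, p1, p2 at most two colours, the triples containing the
   missing colours would violate one of these constraints (a finite check), so
   p0, p1, p2 are rainbow, and then every triple has one of its two intended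
   colourings. In them "x = y or z = 0" becomes N(x,y,z_z) and "x = y or z = 1"
   becomes N(x,y,w_z), and fixing a variable to 0 or 1 becomes N(x,p0,p2) or
   N(x,p1,p2).

   The vertices of [v] are 4(v+1), 4(v+1)+1, 4(v+1)+2, so that their encodings
   arise from that of v+1 by prefixing two digits, and a variable of the source
   instance is out of range exactly when its vertices are: the machine need not
   compare numbers. Vertices 3 and 4(v+1)+3 are tied to others. On syntactic
   errors the output starts with [false], which leaves no variables to be
   surjective. *)

From Stdlib Require Import List NArith ZArith Lia FunctionalExtensionality.
Import ListNotations.
Require Import Defs.

(** * Structured programs and their compilation *)

(** Loops carry no condition: [CBreak] leaves the innermost [CRepeat], while [CFail] leaves all of
    them, so that a syntax error met deep inside the parser aborts the whole run. *)
Inductive cmd : Type :=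
  | CSkip
  | CPush (r : nat) (b : bool)
  | CSeq (c1 c2 : cmd)
  | CCase (r : nat) (ce cf ct : cmd)
  | CRepeat (c : cmd)
  | CBreak
  | CFail.

Inductive outcome : Type := Norm | Brk | Failed.

Notation state := (nat -> list bool).

(* The last argument bounds the number of machine steps of the compiled code
   from above; the additive constants account for the two-instruction jumps. *)
Inductive bigstep : cmd -> state -> outcome -> state -> nat -> Prop :=
  | bs_skip s : bigstep CSkip s Norm s 0
  | bs_push r b s : bigstep (CPush r b) s Norm (upd s r (b :: s r)) 1
  | bs_seq c1 c2 s1 s2 s3 o k1 k2 :
      bigstep c1 s1 Norm s2 k1 -> bigstep c2 s2 o s3 k2 ->
      bigstep (CSeq c1 c2) s1 o s3 (k1 + k2)
  | bs_seq_exit c1 c2 s1 s2 o k :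
      bigstep c1 s1 o s2 k -> o <> Norm -> bigstep (CSeq c1 c2) s1 o s2 k
  | bs_case_nil r ce cf ct s s' o k :
      s r = [] -> bigstep ce s o s' k ->
      bigstep (CCase r ce cf ct) s o s' (k + 3)
  | bs_case_cons r ce cf ct (b : bool) l s s' o k :
      s r = b :: l -> bigstep (if b then ct else cf) (upd s r l) o s' k ->
      bigstep (CCase r ce cf ct) s o s' (k + 3)
  | bs_repeat_next c s1 s2 s3 o k1 k2 :
      bigstep c s1 Norm s2 k1 -> bigstep (CRepeat c) s2 o s3 k2 ->
      bigstep (CRepeat c) s1 o s3 (k1 + 2 + k2)
  | bs_repeat_break c s1 s2 k :
      bigstep c s1 Brk s2 k -> bigstep (CRepeat c) s1 Norm s2 k
  | bs_repeat_fail c s1 s2 k :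
      bigstep c s1 Failed s2 k -> bigstep (CRepeat c) s1 Failed s2 k
  | bs_break s : bigstep CBreak s Brk s 2
  | bs_fail s : bigstep CFail s Failed s 2
  | bs_weaken c s o s' k k' :
      bigstep c s o s' k -> k <= k' -> bigstep c s o s' k'.

Fixpoint size (c : cmd) : nat :=
  match c with
  | CSkip => 0
  | CPush _ _ => 1
  | CSeq c1 c2 => size c1 + size c2
  | CCase _ ce cf ct => 1 + (size ce + (2 + (size cf + (2 + size ct))))
  | CRepeat c => size c + 2
  | CBreak | CFail => 2
  end.

(* There is no jump instruction: pushing a bit and popping it again leaves the
   registers unchanged and lets [Pop] choose the target. *)
Definition goto (t : nat) : list instr := [Push 0 false; Pop 0 t t t].

(** Jump targets are absolute, so the code depends on its own address [a] and on the addresses [brk]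
    and [fl] that serve the two abnormal exits. Its length depends on none of them, so forward
    targets can be computed from [size]. *)
Fixpoint comp (a brk fl : nat) (c : cmd) : list instr :=
  match c with
  | CSkip => []
  | CPush r b => [Push r b]
  | CSeq c1 c2 => comp a brk fl c1 ++ comp (a + size c1) brk fl c2
  | CCase r ce cf ct =>
      let a0 := a + 1 in
      let a1 := a0 + size ce + 2 in
      let a2 := a1 + size cf + 2 in
      let e := a2 + size ct in
      [Pop r a0 a1 a2] ++ comp a0 brk fl ce ++ goto e ++
      comp a1 brk fl cf ++ goto e ++ comp a2 brk fl ct
  | CRepeat c => comp a (a + size c + 2) fl c ++ goto a
  | CBreak => goto brk
  | CFail => goto fl
  end.

Lemma length_comp c : forall a brk fl, length (comp a brk fl c) = size c.
Proof.
  induction c; intros a brk fl; cbn; rewrite ?length_app; cbn;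
    rewrite ?length_app; cbn; rewrite ?length_app; cbn; auto;
    rewrite ?IHc, ?IHc1, ?IHc2, ?IHc3; lia.
Qed.

(** * Correctness of the compilation *)

Definition code_at (p : list instr) (a : nat) (l : list instr) : Prop :=
  exists pre post, p = pre ++ l ++ post /\ length pre = a.

Lemma code_at_app p a l1 l2 :
  code_at p a (l1 ++ l2) -> code_at p a l1 /\ code_at p (a + length l1) l2.
Proof.
  intros (pre & post & -> & <-). split.
  - exists pre, (l2 ++ post). now rewrite <- !app_assoc.
  - exists (pre ++ l1), post. now rewrite length_app, <- !app_assoc.
Qed.

Lemma code_at_nth p a i l : code_at p a (i :: l) -> nth_error p a = Some i.
Proof.
  intros (pre & post & -> & <-).
  now rewrite nth_error_app2, Nat.sub_diag by lia.
Qed.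

(** Leaving the remaining fuel [m] arbitrary makes the relation compose, and [k] is only an upper
    bound, in agreement with the costs of [bigstep]. *)
Definition reach (p : list instr) (k : nat) (s s' : mstate) : Prop :=
  exists k', k' <= k /\ forall m, run p (k' + m) s = run p m s'.

Lemma reach_refl p s : reach p 0 s s.
Proof. exists 0. split; auto. Qed.

Lemma reach_trans p k1 k2 s1 s2 s3 :
  reach p k1 s1 s2 -> reach p k2 s2 s3 -> reach p (k1 + k2) s1 s3.
Proof.
  intros (m1 & H1 & E1) (m2 & H2 & E2). exists (m1 + m2). split; [lia|].
  intros m. now rewrite <- Nat.add_assoc, E1.
Qed.

Lemma reach_le p k k' s s' : reach p k s s' -> k <= k' -> reach p k' s s'.
Proof. intros (m & H & E) L. exists m. split; [lia|auto]. Qed.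

Lemma reach_step p i s : nth_error p (pc s) = Some i -> reach p 1 s (exec i s).
Proof. intros H. exists 1. split; auto. intros m. cbn. now rewrite H. Qed.

Lemma upd_id s r : upd s r (s r) = s.
Proof.
  extensionality q. unfold upd. now destruct (Nat.eqb_spec q r); subst.
Qed.

Lemma upd_same s r l : upd s r l r = l.
Proof. unfold upd. now rewrite Nat.eqb_refl. Qed.

Lemma upd_other s r q l : q <> r -> upd s r l q = s q.
Proof. unfold upd. now intros ->%Nat.eqb_neq. Qed.

Lemma upd_upd s r l l' : upd (upd s r l) r l' = upd s r l'.
Proof. extensionality q. unfold upd. now destruct (Nat.eqb q r). Qed.

Lemma reach_goto p a t l s :
  code_at p a (goto t ++ l) -> reach p 2 (MState a s) (MState t s).
Proof.
  intros H.
  assert (H1 := code_at_nth _ _ _ _ H).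
  apply (code_at_app p a [Push 0 false]) in H as [_ H].
  apply code_at_nth in H.
  cbn [length] in H. rewrite Nat.add_1_r in H.
  apply (reach_trans p 1 1 _ _ _ (reach_step p _ (MState a s) H1)).
  cbn [exec pc regs].
  set (s1 := MState _ _). assert (R := reach_step p _ s1 H). subst s1.
  cbn in R. now rewrite upd_upd, upd_id in R.
Qed.

(** The induction is on the derivation, not on the command, because the rest of a loop runs the same
    code again at the same address. The three outcomes are treated together, each with its own exit
    address. *)
Lemma comp_correct c s o s' k :
  bigstep c s o s' k -> forall p a brk fl, code_at p a (comp a brk fl c) ->
  reach p k (MState a s)
    (MState (match o with Norm => a + size c | Brk => brk | Failed => fl end) s').
Proof.
  induction 1; intros p a brk fl C; cbn [comp size] in *.
  - rewrite Nat.add_0_r. apply reach_refl.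
  - rewrite Nat.add_1_r.
    apply (reach_step p (Push r b) (MState a s)). now apply code_at_nth in C.
  - apply code_at_app in C as [C1 C2]. rewrite length_comp in C2.
    eapply reach_trans; [now apply IHbigstep1 in C1; apply C1|].
    apply IHbigstep2 in C2. now rewrite Nat.add_assoc.
  - apply code_at_app in C as [C1 _]. apply IHbigstep in C1.
    now destruct o.
  - assert (C0 := code_at_nth _ _ _ _ C).
    apply code_at_app in C as [_ C]. cbn [length] in C.
    apply code_at_app in C as [C1 C2].
    rewrite length_comp in C2.
    (* One step for the pop, two for the jump over the other branches. *)
    rewrite Nat.add_comm. change 3 with (1 + 2). rewrite <- Nat.add_assoc.
    eapply reach_trans; [apply (reach_step p _ (MState a s) C0)|].
    cbn [exec regs pc]. rewrite H. rewrite (Nat.add_comm 2).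
    apply IHbigstep in C1.
    eapply reach_trans; [exact C1|].
    destruct o.
    + apply (reach_goto _ _ _ _ s') in C2. eapply eq_rect; [exact C2|].
      f_equal. lia.
    + eapply reach_le; [apply reach_refl|lia].
    + eapply reach_le; [apply reach_refl|lia].
  - assert (C0 := code_at_nth _ _ _ _ C).
    apply code_at_app in C as [_ C]. cbn [length] in C.
    apply code_at_app in C as [_ C].
    apply code_at_app in C as [_ C].
    apply code_at_app in C as [C1 C].
    rewrite !length_comp in *. cbn [goto length] in C1, C.
    rewrite Nat.add_comm. change 3 with (1 + 2). rewrite <- Nat.add_assoc.
    eapply reach_trans; [apply (reach_step p _ (MState a s) C0)|].
    cbn [exec regs pc]. rewrite H. rewrite (Nat.add_comm 2).
    destruct b.
    + apply code_at_app in C as [_ C]. cbn [goto length] in C.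
      apply IHbigstep in C.
      eapply reach_le; [|apply Nat.le_add_r].
      eapply eq_rect; [exact C|]. f_equal. destruct o; lia.
    + apply IHbigstep in C1. eapply reach_trans; [exact C1|].
      destruct o.
      * apply (reach_goto _ _ _ _ s') in C. eapply eq_rect; [exact C|].
        f_equal. lia.
      * eapply reach_le; [apply reach_refl|lia].
      * eapply reach_le; [apply reach_refl|lia].
  - assert (C' := C). apply code_at_app in C as [C1 C2].
    rewrite length_comp in C2. rewrite <- (app_nil_r (goto a)) in C2.
    eapply reach_trans; [|exact (IHbigstep2 p a brk fl C')].
    eapply reach_trans; [now apply IHbigstep1 in C1; apply C1|].
    apply reach_goto with (1 := C2).
  - apply code_at_app in C as [C1 _]. apply IHbigstep in C1.
    now rewrite Nat.add_assoc.
  - apply code_at_app in C as [C1 _]. now apply IHbigstep in C1.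
  - rewrite <- (app_nil_r (goto _)) in C. apply reach_goto with (1 := C).
  - rewrite <- (app_nil_r (goto _)) in C. apply reach_goto with (1 := C).
  - eapply reach_le; eauto.
Qed.

(** Normal termination arrives at the jump at address [size c], which skips the last instruction and
    leaves the program; failure enters at [size c + 2] and pushes [false] onto the output. *)
Definition program (c : cmd) : list instr :=
  comp 0 0 (size c + 2) c ++ goto (size c + 3) ++ [Push 1 false].

Lemma program_run c s o s' k K :
  bigstep c s o s' k -> o <> Brk -> k + 2 <= K ->
  exists q, run (program c) K (MState 0 s) = Some (MState q
    match o with Norm => s' | _ => upd s' 1 (false :: s' 1) end).
Proof.
  intros B O L.
  assert (C : code_at (program c) 0 (program c)).
  { exists [], []. now rewrite app_nil_r. }
  assert (H : nth_error (program c) (size c + 3) = None).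
  { apply nth_error_None. unfold program. rewrite !length_app, length_comp. cbn. lia. }
  apply code_at_app in C as [C1 C2]. rewrite length_comp in C2.
  assert (R := comp_correct _ _ _ _ _ B _ _ _ _ C1).
  assert (R' : reach (program c) (k + 2) (MState 0 s) (MState (size c + 3)
    match o with Norm => s' | _ => upd s' 1 (false :: s' 1) end)).
  { eapply reach_trans; [exact R|]. destruct o; [|congruence|].
    - apply reach_goto with (1 := C2).
    - apply code_at_app in C2 as [_ C2]. cbn [goto length] in C2.
      apply code_at_nth in C2. rewrite (Nat.add_0_l (size c)) in C2.
      assert (E := reach_step _ _ (MState (size c + 2) s') C2).
      cbn [exec pc regs] in E.
      replace (size c + 3) with (S (size c + 2)) by lia.
      eapply reach_le; [exact E|lia]. }
  exists (size c + 3). destruct R' as (k' & Lk & E).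
  replace K with (k' + (K - k')) by lia. rewrite E.
  destruct (K - k'); cbn; now rewrite H.
Qed.

(** * Encodings *)

Fixpoint pos_bits (p : positive) : list bool :=
  match p with
  | xH => [true]
  | xO q => false :: pos_bits q
  | xI q => true :: pos_bits q
  end.

(* Least significant bit first, without leading zeros; [0] is the empty list. *)
Definition bits (n : nat) : list bool :=
  match N.of_nat n with N0 => [] | Npos p => pos_bits p end.

(** Every digit is announced by [true]; a [false] in the position of an announcement ends the
    number. *)
Fixpoint tagged (l : list bool) : list bool :=
  match l with [] => [] | b :: l' => true :: b :: tagged l' end.

Lemma tagged_app l1 l2 : tagged (l1 ++ l2) = tagged l1 ++ tagged l2.
Proof. induction l1; cbn; congruence. Qed.

Lemma length_tagged l : length (tagged l) = 2 * length l.
Proof. induction l; cbn; lia. Qed.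

Lemma enc_nat_bits n : enc_nat n = tagged (bits n) ++ [false].
Proof.
  unfold enc_nat, bits. destruct (N.of_nat n) as [|p]; auto.
  induction p; cbn; congruence.
Qed.

Lemma pos_bits_nonempty p : pos_bits p <> [].
Proof. destruct p; discriminate. Qed.

Lemma pos_bits_inj p : forall q, pos_bits p = pos_bits q -> p = q.
Proof.
  induction p; intros [q|q|]; cbn; intros E; try discriminate; auto;
    injection E as E; try (now f_equal; apply IHp).
  - now apply pos_bits_nonempty in E.
  - now destruct (pos_bits_nonempty q).
Qed.

Lemma bits_inj m n : bits m = bits n -> m = n.
Proof.
  unfold bits. intros E. apply Nat2N.inj.
  destruct (N.of_nat m), (N.of_nat n); auto.
  - now destruct (pos_bits_nonempty p).
  - now destruct (pos_bits_nonempty p).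
  - f_equal. now apply pos_bits_inj.
Qed.

Lemma pos_bits_surj l : exists p, l ++ [true] = pos_bits p.
Proof.
  induction l as [|b l (p & E)]; [now exists xH|].
  exists (if b then xI p else xO p). cbn. rewrite E. now destruct b.
Qed.

(** Together with [bits_msb] this characterises the digit strings of numbers by their last digit,
    which is the test that the parser performs. *)
Lemma bits_surj l : exists n, l ++ [true] = bits n.
Proof.
  destruct (pos_bits_surj l) as [p E]. exists (Pos.to_nat p).
  unfold bits. now rewrite positive_nat_N.
Qed.

Lemma bits_msb n : bits n = [] \/ exists l, bits n = l ++ [true].
Proof.
  unfold bits. destruct (N.of_nat n) as [|p]; auto. right.
  induction p as [p [l E]|p [l E]|]; cbn.
  - exists (true :: l). now rewrite E.
  - exists (false :: l). now rewrite E.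
  - now exists [].
Qed.

Fixpoint incr (l : list bool) : list bool :=
  match l with
  | [] => [true]
  | false :: l' => true :: l'
  | true :: l' => false :: incr l'
  end.

Lemma bits_S n : bits (S n) = incr (bits n).
Proof.
  unfold bits. rewrite Nat2N.inj_succ. destruct (N.of_nat n) as [|p]; auto.
  cbn. induction p; cbn; congruence.
Qed.

Lemma length_incr l : length (incr l) <= S (length l).
Proof. induction l as [|[] l]; cbn; lia. Qed.

(** A linear bound suffices, since the loop indices do not exceed the variable count, which the
    input gives in unary. *)
Lemma length_bits n : length (bits n) <= n.
Proof.
  induction n; [cbn; lia|]. rewrite bits_S.
  assert (H := length_incr (bits n)). lia.
Qed.

Definition tag (b0 b1 : bool) (n : nat) : nat :=
  4 * n + (2 * Nat.b2n b1 + Nat.b2n b0).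

(** For [n = 0] the prefixed digits could become leading zeros; this is one reason for shifting
    variables by one. *)
Lemma bits_tag b0 b1 n : 0 < n -> bits (tag b0 b1 n) = b0 :: b1 :: bits n.
Proof.
  intros H. unfold bits, tag. destruct n as [|n]; [lia|].
  set (p := Pos.of_succ_nat n).
  replace (N.of_nat (S n)) with (Npos p) by reflexivity.
  replace (N.of_nat _) with
    (Npos (match b0 with true => xI | false => xO end
            (match b1 with true => xI | false => xO end p))).
  - now destruct b0, b1.
  - assert (E : N.of_nat (S n) = Npos p) by reflexivity.
    destruct b0, b1; cbn [Nat.b2n]; lia.
Qed.

(** The remainders [r1] and [r2] express prefix-freeness, which is inherited by concatenations; the
    injectivity lemmas for numbers, scopes and constraints keep this form. *)
Lemma tagged_false_inj l1 : forall l2 r1 r2,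
  tagged l1 ++ false :: r1 = tagged l2 ++ false :: r2 -> l1 = l2 /\ r1 = r2.
Proof.
  induction l1 as [|a l1 IH]; intros [|b l2] r1 r2; cbn; intros E; try discriminate.
  - injection E as E. auto.
  - injection E as -> E. apply IH in E as [-> ->]. auto.
Qed.

Lemma enc_nat_inj m n r1 r2 :
  enc_nat m ++ r1 = enc_nat n ++ r2 -> m = n /\ r1 = r2.
Proof.
  rewrite !enc_nat_bits, <- !app_assoc. intros E.
  apply tagged_false_inj in E as [E ->]. split; auto. now apply bits_inj.
Qed.

(** A scope has no end marker of its own; the equality of lengths comes from the length field in
    [enc_constr]. *)
Lemma enc_nats_inj l1 : forall l2 r1 r2, length l1 = length l2 ->
  concat (map enc_nat l1) ++ r1 = concat (map enc_nat l2) ++ r2 ->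
  l1 = l2 /\ r1 = r2.
Proof.
  induction l1 as [|a l1 IH]; intros [|b l2] r1 r2; try discriminate; cbn; auto.
  intros [= L]. rewrite <- !app_assoc. intros E.
  apply enc_nat_inj in E as [-> E]. apply IH in E as [-> ->]; auto.
Qed.

Lemma enc_constr_inj c1 c2 r1 r2 :
  enc_constr c1 ++ r1 = enc_constr c2 ++ r2 -> c1 = c2 /\ r1 = r2.
Proof.
  destruct c1 as [i l], c2 as [j l']. unfold enc_constr. cbn [fst snd].
  rewrite <- !app_assoc. intros E.
  apply enc_nat_inj in E as [-> E]. apply enc_nat_inj in E as [L E].
  apply enc_nats_inj in E as [-> ->]; auto.
Qed.

Lemma enc_constr_nonempty c r : enc_constr c ++ r <> [].
Proof.
  unfold enc_constr. rewrite enc_nat_bits. now destruct (bits (fst c)).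
Qed.

Notation enc_constrs cs := (concat (map enc_constr cs)).

Lemma enc_constrs_inj cs1 : forall cs2, enc_constrs cs1 = enc_constrs cs2 -> cs1 = cs2.
Proof.
  induction cs1 as [|c cs1 IH]; intros [|c' cs2]; cbn; auto; intros E.
  - symmetry in E. now apply enc_constr_nonempty in E.
  - now apply enc_constr_nonempty in E.
  - apply enc_constr_inj in E as [-> E]. f_equal. auto.
Qed.

Lemma unary_inj m : forall n r1 r2,
  repeat true m ++ false :: r1 = repeat true n ++ false :: r2 -> m = n /\ r1 = r2.
Proof.
  induction m as [|m IH]; intros [|n] r1 r2; cbn; intros E; try discriminate;
    injection E as E; auto.
  apply IH in E as [-> ->]. auto.
Qed.

Lemma enc_instance_inj I1 I2 : enc_instance I1 = enc_instance I2 -> I1 = I2.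
Proof.
  destruct I1, I2. unfold enc_instance. cbn. intros E.
  apply unary_inj in E as [-> E]. f_equal. now apply enc_constrs_inj.
Qed.

(** * Program fragments *)

Ltac upd_ext :=
  let q := fresh "q" in extensionality q; unfold upd;
  repeat match goal with
    | |- context [Nat.eqb ?a ?b] => destruct (Nat.eqb_spec a b) end;
  subst; try lia; try congruence; auto.

Ltac upd_lookup :=
  repeat first [rewrite upd_same | rewrite upd_other by (auto; lia)].

Lemma bs_eq c (s : state) o (s1 s2 : state) k : bigstep c s o s1 k -> s1 = s2 -> bigstep c s o s2 k.
Proof. now intros ? <-. Qed.

Definition while (r : nat) (cf ct : cmd) : cmd := CRepeat (CCase r CBreak cf ct).

Lemma while_nil r cf ct (s : state) : s r = [] -> bigstep (while r cf ct) s Norm s 5.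
Proof. intros H. apply bs_repeat_break, (bs_case_nil _ _ _ _ _ _ _ 2); auto. constructor. Qed.

Lemma while_cons r cf ct b l (s s1 s2 : state) o k1 k2 :
  s r = b :: l -> bigstep (if b then ct else cf) (upd s r l) Norm s1 k1 ->
  bigstep (while r cf ct) s1 o s2 k2 ->
  bigstep (while r cf ct) s o s2 (k1 + 5 + k2).
Proof.
  intros H H1 H2. eapply bs_weaken.
  - eapply bs_repeat_next; [|exact H2]. eapply bs_case_cons; eauto.
  - lia.
Qed.

Definition clear (r : nat) : cmd := while r CSkip CSkip.

Lemma clear_correct r (s : state) : bigstep (clear r) s Norm (upd s r []) (5 * length (s r) + 5).
Proof.
  remember (s r) as l eqn:E. symmetry in E. revert s E. induction l as [|b l IH]; intros s E.
  - eapply bs_eq; [now apply while_nil|]. now rewrite <- E, upd_id.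
  - eapply bs_weaken.
    + eapply while_cons; [exact E| |].
      * destruct b; constructor.
      * specialize (IH (upd s r l)). rewrite upd_same, upd_upd in IH. now apply IH.
    + cbn. lia.
Qed.

(** Moving reverses the stack and so exchanges the two digit orders, most or least significant digit
    on top. *)
Definition move (a b : nat) : cmd := while a (CPush b false) (CPush b true).

Lemma move_correct a b (s : state) : a <> b ->
  bigstep (move a b) s Norm (upd (upd s a []) b (rev (s a) ++ s b)) (6 * length (s a) + 5).
Proof.
  intros D. remember (s a) as l eqn:E. symmetry in E. revert s E. induction l as [|x l IH]; intros s E.
  - eapply bs_eq;
      [now apply while_nil|]. upd_ext.
  - eapply bs_weaken.
    + eapply while_cons with (s1 := upd (upd s a l) b (x :: s b)); [exact E| |].
      * rewrite <- (upd_other s a b l) by auto.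
        destruct x; apply bs_push.
      * eapply eq_rect with (P := fun s' => bigstep _ _ _ s' _).
        -- apply IH. rewrite upd_other, upd_same; auto.
        -- rewrite upd_same. cbn [rev]. rewrite <- app_assoc. cbn [app]. upd_ext.
    + cbn. lia.
Qed.

(** The output register is a stack, so everything is written back to front. *)
Fixpoint push_list (l : list bool) : cmd :=
  match l with [] => CSkip | b :: l' => CSeq (push_list l') (CPush 1 b) end.

Lemma push_list_correct l (s : state) :
  bigstep (push_list l) s Norm (upd s 1 (l ++ s 1)) (length l).
Proof.
  induction l as [|b l IH]; cbn.
  - rewrite upd_id. constructor.
  - eapply bs_weaken.
    + eapply bs_seq; [exact IH|].
      eapply bs_eq; [apply bs_push|]. now rewrite upd_same, upd_upd.
    + lia.
Qed.

(* Registers: 0 input, 1 output, 2, 4 and 5 hold variable numbers (most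
   significant bit on top, shifted by one), 3 is scratch space (empty between
   fragments), 6, 7 and 8 are unary loop counters. *)

Definition ripple (r : nat) : cmd :=
  CRepeat (CCase 3 (CSeq (CPush r true) CBreak) (CSeq (CPush r true) CBreak) (CPush r false)).

(** The carry turns each leading [true] into [false] and stops at the first [false] or at the end of
    the number. The processed digits [z] land on [r] in reverse order, and the untouched digits [y]
    stay in register 3. *)
Lemma ripple_correct r (s : state) : r <> 3 -> exists y z,
  incr (s 3) = rev z ++ y /\
  bigstep (ripple r) s Norm (upd (upd s 3 y) r (z ++ s r)) (6 * length (s 3) + 6).
Proof.
  intros D. remember (s 3) as l eqn:E. symmetry in E. revert s E. induction l as [|[] l IH]; intros s E.
  - exists [], [true]. split; auto. eapply bs_weaken.
    + apply bs_repeat_break, bs_case_nil; auto. eapply bs_seq; [apply bs_push|].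
      eapply bs_eq; [constructor|]. upd_ext.
    + cbn. lia.
  - destruct (IH (upd (upd s 3 l) r (false :: s r))) as (y & z & Ei & B).
    { rewrite upd_other, upd_same; auto. }
    exists y, (z ++ [false]). rewrite rev_app_distr. cbn. split; [congruence|].
    eapply bs_weaken.
    + eapply bs_repeat_next.
      * eapply bs_case_cons; [exact E|].
        eapply bs_eq; [apply bs_push|].
        reflexivity.
      * rewrite upd_other by auto.
        eapply bs_eq; [exact B|].
        rewrite upd_same. rewrite <- app_assoc. cbn [app]. upd_ext.
    + cbn. lia.
  - exists l, [true]. split; auto. eapply bs_weaken.
    + apply bs_repeat_break. eapply bs_case_cons; [exact E|].
      eapply bs_seq; [apply bs_push|].
      eapply bs_eq; [constructor|].
      rewrite upd_other by auto. upd_ext.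
    + cbn. lia.
Qed.

Definition increment (r : nat) : cmd := CSeq (move r 3) (CSeq (ripple r) (move 3 r)).

Lemma increment_correct r (s : state) n : r <> 3 -> s 3 = [] -> s r = rev (bits n) ->
  bigstep (increment r) s Norm (upd s r (rev (bits (S n)))) (18 * length (bits n) + 22).
Proof.
  intros D E3 Er.
  assert (B1 := move_correct r 3 s D).
  rewrite E3, Er, rev_involutive, app_nil_r, length_rev in B1.
  destruct (ripple_correct r (upd (upd s r []) 3 (bits n)) D) as (y & z & Ei & B2).
  rewrite upd_same, (upd_other _ 3 r), upd_same, upd_upd, app_nil_r in B2 by auto.
  rewrite upd_same in Ei.
  assert (B3 := move_correct 3 r (upd (upd (upd s r []) 3 y) r z) (not_eq_sym D)).
  rewrite upd_same, (upd_other _ r 3), upd_same in B3 by auto.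
  rewrite bits_S, Ei, rev_app_distr, rev_involutive.
  assert (L := f_equal (@length bool) Ei).
  assert (L' := length_incr (bits n)). rewrite length_app in L.
  eapply bs_weaken.
  - eapply bs_seq; [exact B1|]. eapply bs_seq; [exact B2|].
    eapply bs_eq; [exact B3|]. upd_ext.
  - lia.
Qed.

(** * Writing constraints to the output *)

Inductive slot : Type := SC (c : nat) | SR (r : nat) (b0 b1 : bool).

(** A slot denotes a vertex that is either fixed in the program or obtained at run time by prefixing
    two digits to the number in a register; [rho] gives the register contents as numbers. *)
Definition sval (rho : nat -> nat) (sl : slot) : nat :=
  match sl with SC c => c | SR r b0 b1 => tag b0 b1 (rho r) end.

(** The most significant digit is on top of [r], so popping yields the digits in the order in which
    a back-to-front output needs them. Register 3 keeps a copy from which [r] is restored, and the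
    two low digits come last. *)
Definition emit_reg (r : nat) (b0 b1 : bool) : cmd :=
  CSeq (CPush 1 false)
  (CSeq (while r (CSeq (CPush 1 false) (CSeq (CPush 1 true) (CPush 3 false)))
                 (CSeq (CPush 1 true) (CSeq (CPush 1 true) (CPush 3 true))))
  (CSeq (move 3 r) (push_list [true; b0; true; b1]))).

Lemma emit_reg_correct r b0 b1 (s : state) n :
  r <> 1 -> r <> 3 -> s 3 = [] -> s r = rev (bits n) -> 0 < n ->
  bigstep (emit_reg r b0 b1) s Norm (upd s 1 (enc_nat (tag b0 b1 n) ++ s 1))
    (14 * length (s r) + 15).
Proof.
  intros D1 D3 E3 Er P.
  assert (W : forall l s, s r = l ->
    bigstep (while r (CSeq (CPush 1 false) (CSeq (CPush 1 true) (CPush 3 false)))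
                     (CSeq (CPush 1 true) (CSeq (CPush 1 true) (CPush 3 true))))
      s Norm (upd (upd (upd s r []) 3 (rev l ++ s 3)) 1 (tagged (rev l) ++ s 1))
      (8 * length l + 5)).
  { clear - D1 D3. intros l. induction l as [|x l IH]; intros s E.
    - eapply bs_eq; [now apply while_nil|]. upd_ext.
    - eapply bs_weaken.
      + eapply while_cons with (k1 := 3)
          (s1 := upd (upd (upd s r l) 1 (true :: x :: s 1)) 3 (x :: s 3)); [exact E| |].
        * destruct x; (eapply (bs_seq _ _ _ _ _ _ 1 2); [apply bs_push|];
            eapply (bs_seq _ _ _ _ _ _ 1 1); [apply bs_push|];
            eapply bs_eq; [apply bs_push|]); upd_lookup; upd_ext.
        * eapply bs_eq; [apply IH; now upd_lookup|]. upd_lookup. cbn [rev].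
          rewrite tagged_app, <- !app_assoc. cbn [tagged app]. upd_ext.
      + cbn. lia. }
  eapply bs_weaken.
  - eapply bs_seq; [apply bs_push|]. eapply bs_seq.
    { apply (W (s r)). now upd_lookup. }
    eapply bs_seq; [apply move_correct; auto|].
    eapply bs_eq; [apply push_list_correct|].
    upd_lookup. rewrite Er, E3, rev_involutive, !app_nil_r, enc_nat_bits, bits_tag by auto.
    cbn [tagged app]. rewrite <- app_assoc. cbn [app]. upd_ext.
  - upd_lookup. rewrite E3, app_nil_r, length_rev. cbn. lia.
Qed.

Definition slot_ok (rho : nat -> nat) (B : nat) (s : state) (sl : slot) : Prop :=
  match sl with
  | SC c => c < 4
  | SR r _ _ => r <> 1 /\ r <> 3 /\ s r = rev (bits (rho r)) /\ 0 < rho r /\ length (s r) <= B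
  end.

Definition emit_slot (sl : slot) : cmd :=
  match sl with SC c => push_list (enc_nat c) | SR r b0 b1 => emit_reg r b0 b1 end.

Lemma emit_slot_correct rho B (s : state) sl : s 3 = [] -> slot_ok rho B s sl ->
  bigstep (emit_slot sl) s Norm (upd s 1 (enc_nat (sval rho sl) ++ s 1)) (15 * (B + 1)).
Proof.
  intros E3. destruct sl as [c|r b0 b1]; cbn.
  - intros H. eapply bs_weaken; [apply push_list_correct|].
    do 4 (destruct c as [|c]; [cbn; lia|]). lia.
  - intros (H1 & H3 & Hr & P & L).
    eapply bs_weaken; [now apply emit_reg_correct|lia].
Qed.

Notation slots := (slot * slot * slot)%type.

Definition constr_of (rho : nat -> nat) (t : slots) : nat * list nat :=
  let '(x, y, z) := t in (0, [sval rho x; sval rho y; sval rho z]).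

Definition emit (t : slots) : cmd :=
  let '(x, y, z) := t in
  CSeq (emit_slot z) (CSeq (emit_slot y) (CSeq (emit_slot x) (push_list (enc_nat 0 ++ enc_nat 3)))).

Definition slots_ok rho B (s : state) (t : slots) : Prop :=
  let '(x, y, z) := t in slot_ok rho B s x /\ slot_ok rho B s y /\ slot_ok rho B s z.

Lemma slot_ok_output rho B s l sl : slot_ok rho B s sl -> slot_ok rho B (upd s 1 l) sl.
Proof. destruct sl; cbn; auto. intros (H1 & H3 & H). rewrite upd_other; auto. Qed.

Lemma emit_correct rho B (s : state) t : s 3 = [] -> slots_ok rho B s t ->
  bigstep (emit t) s Norm (upd s 1 (enc_constr (constr_of rho t) ++ s 1)) (51 * (B + 1)).
Proof.
  destruct t as [[x y] z]. intros E3 (Hx & Hy & Hz).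
  eapply bs_weaken.
  - eapply bs_seq; [apply emit_slot_correct with (rho := rho) (B := B); auto|].
    eapply bs_seq; [apply emit_slot_correct with (rho := rho) (B := B); auto using slot_ok_output|].
    eapply bs_seq; [apply emit_slot_correct with (rho := rho) (B := B); auto using slot_ok_output|].
    eapply bs_eq; [apply push_list_correct|].
    rewrite !upd_same, !upd_upd. unfold enc_constr. cbn [constr_of fst snd length map concat].
    rewrite app_nil_r, <- !app_assoc. reflexivity.
  - cbn. lia.
Qed.

Definition emits (ts : list slots) : cmd :=
  fold_right (fun t c => CSeq (emit t) c) CSkip ts.

(** Each constraint is put in front of the earlier ones, hence the [rev]; a conjunction does not
    depend on the order. *)
Lemma emits_correct rho B ts : forall s, s 3 = [] -> Forall (slots_ok rho B s) ts ->
  bigstep (emits ts) s Norm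
    (upd s 1 (enc_constrs (rev (map (constr_of rho) ts)) ++ s 1)) (51 * (B + 1) * length ts).
Proof.
  induction ts as [|t ts IH]; intros s E3 H; cbn [emits fold_right map rev].
  - cbn. rewrite upd_id. eapply bs_weaken; [constructor|lia].
  - inversion_clear H as [|? ? Ht Hts]. eapply bs_weaken.
    + eapply bs_seq; [apply emit_correct with (rho := rho) (B := B); auto|].
      eapply bs_eq.
      * apply IH; auto. eapply Forall_impl; [|exact Hts].
        intros [[x y] z] (Hx & Hy & Hz). cbn. auto using slot_ok_output.
      * rewrite upd_same, upd_upd, map_app, concat_app, <- app_assoc. cbn [map concat].
        now rewrite app_nil_r.
    + cbn [length]. lia.
Qed.

(** * Parsing *)

(** Failure carries a refutation of every possible decoding. Thus the machine not only accepts
    correct codes but rejects none of them. *)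
Definition parses {A} (c : cmd) (s : state) (enc : A -> list bool)
    (post : A -> state -> Prop) (k : nat) : Prop :=
  (exists a s', s 0 = enc a ++ s' 0 /\ bigstep c s Norm s' k /\ post a s') \/
  (exists s', bigstep c s Failed s' k /\ forall a l, s 0 <> enc a ++ l).

(** If the second parser fails, another decoding of the first component might still succeed; unique
    decodability of [enc1] excludes this. *)
Lemma parses_seq A1 A2 c1 c2 s (enc1 : A1 -> list bool) (enc2 : A2 -> list bool)
    post1 post2 k1 k2 :
  (forall a a' l l', enc1 a ++ l = enc1 a' ++ l' -> a = a' /\ l = l') ->
  parses c1 s enc1 post1 k1 ->
  (forall a s', post1 a s' -> parses c2 s' enc2 (fun b => post2 (a, b)) k2) ->
  parses (CSeq c1 c2) s (fun p => enc1 (fst p) ++ enc2 (snd p)) post2 (k1 + k2).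
Proof.
  intros inj [(a & s1 & E1 & B1 & P1)|(s1 & B1 & F1)] H2.
  - destruct (H2 _ _ P1) as [(b & s2 & E2 & B2 & P2)|(s2 & B2 & F2)].
    + left. exists (a, b), s2. cbn. rewrite <- app_assoc, <- E2.
      eauto using bs_seq.
    + right. exists s2. split; [eauto using bs_seq|].
      intros [a' b] l E. cbn in E. rewrite E1, <- app_assoc in E.
      apply inj in E as [_ E]. now apply F2 in E.
  - right. exists s1. split.
    + eapply bs_weaken; [apply bs_seq_exit; [exact B1|discriminate]|lia].
    + intros [a b] l. cbn. rewrite <- app_assoc. apply F1.
Qed.

Lemma parses_then A c1 c2 s (enc : A -> list bool) post1 (post2 : A -> state -> Prop) k1 k2 :
  parses c1 s enc post1 k1 ->
  (forall a s', post1 a s' ->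
    exists s'', bigstep c2 s' Norm s'' k2 /\ s'' 0 = s' 0 /\ post2 a s'') ->
  parses (CSeq c1 c2) s enc post2 (k1 + k2).
Proof.
  intros [(a & s1 & E1 & B1 & P1)|(s1 & B1 & F1)] H2.
  - left. destruct (H2 _ _ P1) as (s2 & B2 & E2 & P2). exists a, s2.
    rewrite E2. eauto using bs_seq.
  - right. exists s1. split; auto.
    eapply bs_weaken; [apply bs_seq_exit; [exact B1|discriminate]|lia].
Qed.

Definition read_tagged (r : nat) : cmd :=
  CRepeat (CCase 0 CFail CBreak (CCase 0 CFail (CPush r false) (CPush r true))).

Lemma read_tagged_correct r B : r <> 0 -> forall s, length (s 0) <= B ->
  parses (read_tagged r) s (fun l => tagged l ++ [false])
    (fun l s' => s' = upd (upd s 0 (s' 0)) r (rev l ++ s r)) (9 * B + 8).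
Proof.
  (* Strong induction, because one round consumes two bits, the announcement and the digit. *)
  intros D. induction B as [B IH] using lt_wf_ind. intros s L.
  destruct (s 0) as [|[] l] eqn:E.
  - right. exists s. split.
    + eapply bs_weaken; [apply bs_repeat_fail, bs_case_nil; [auto|constructor]|lia].
    + intros l l'. rewrite E. destruct l; discriminate.
  - destruct l as [|b l].
    + right. exists (upd s 0 []). split.
      * eapply bs_weaken; [apply bs_repeat_fail|].
        -- eapply bs_case_cons; [exact E|]. apply bs_case_nil; [apply upd_same|constructor].
        -- cbn in L. lia.
      * intros l l'. rewrite E. destruct l as [|b []]; discriminate.
    + cbn in L. set (s1 := upd (upd s 0 l) r (b :: s r)).
      assert (B1 : bigstep (CCase 0 CFail CBreak (CCase 0 CFail (CPush r false) (CPush r true)))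
                     s Norm s1 7).
      { apply (bs_case_cons _ _ _ _ true (b :: l) _ _ _ 4); auto.
        apply (bs_case_cons _ _ _ _ b l _ _ _ 1); [apply upd_same|].
        eapply bs_eq with (s1 := upd (upd (upd s 0 (b :: l)) 0 l) r (b :: upd (upd s 0 (b :: l)) 0 l r)).
        - destruct b; apply bs_push.
        - subst s1. upd_lookup. now rewrite upd_upd. }
      destruct (IH (B - 2) ltac:(lia) s1) as [(l0 & s' & E0 & B0 & E2)|(s' & B0 & F)].
      * subst s1. upd_lookup. lia.
      * left. exists (b :: l0), (upd (upd s 0 (s' 0)) r (rev (b :: l0) ++ s r)).
        subst s1. upd_lookup. revert E0. upd_lookup. intros E0.
        split; [cbn; congruence|]. split; auto.
        eapply bs_weaken; [eapply bs_repeat_next|].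
        -- exact B1.
        -- eapply bs_eq; [exact B0|]. rewrite E2 at 1. upd_lookup. cbn [rev]. rewrite <- app_assoc.
           cbn [app]. upd_ext.
        -- lia.
      * right. exists s'. split.
        -- eapply bs_weaken; [eapply bs_repeat_next; [exact B1|exact B0]|lia].
        -- intros [|b' l0] l'; cbn; rewrite E; [discriminate|]. intros [= -> El].
           apply (F l0 l'). subst s1. now upd_lookup.
  - left. exists [], (upd s 0 l). upd_lookup. split; auto. split.
    + eapply bs_weaken.
      * apply bs_repeat_break. eapply bs_case_cons; [exact E|constructor].
      * lia.
    + upd_ext.
Qed.

(* The number [v] is stored as [S v] so that the vertices below 4 are free for
   the constants. A leading zero makes the input malformed. *)
Definition read (r : nat) : cmd :=
  CSeq (clear r) (CSeq (CSeq (read_tagged r) (CCase r CSkip CFail (CPush r true))) (increment r)).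

(** The invariant of the parser, used with the input length for [B]. The extra 1 allows for the
    digit that may be gained when a variable is stored as its successor. *)
Definition bounded (B : nat) (s : state) : Prop :=
  s 3 = [] /\ length (s 0) <= B /\
  forall r, r = 2 \/ r = 4 \/ r = 5 -> length (s r) <= B + 1.

Lemma read_correct r B s : r = 2 \/ r = 4 \/ r = 5 -> bounded B s ->
  parses (read r) s enc_nat
    (fun v s' => s' = upd (upd s 0 (s' 0)) r (rev (bits (S v))) /\ bounded B s')
    (60 * (B + 1)).
Proof.
  intros Hr (E3 & L0 & Lr). assert (D : r <> 0 /\ r <> 3) by lia. destruct D as [D0 D3].
  assert (B1 := clear_correct r s). specialize (Lr r Hr) as L.
  destruct (read_tagged_correct r B D0 (upd s r [])) as [(l & s' & E & B2 & E2)|(s' & B2 & F)].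
  - now upd_lookup.
  - revert E E2. upd_lookup. rewrite app_nil_r. intros E E2.
    assert (Er : s' r = rev l) by (rewrite E2; now upd_lookup).
    (* The last digit decides whether the digit string represents a number. *)
    assert (Dec : (exists v, l = bits v) \/ ((exists l0, l = l0 ++ [false]) /\ forall v, l <> bits v)).
    { destruct l as [|x l _] using rev_ind; [left; now exists 0|]. destruct x.
      - left. apply bits_surj.
      - right. split; [eauto|]. intros v Ev.
        destruct (bits_msb v) as [E0|(l0 & E0)]; rewrite E0 in Ev.
        + now destruct l.
        + apply app_inj_tail in Ev as [_ Ev]. discriminate. }
    (* The test pops the most significant digit and, if it is [true], pushes it back. *)
    assert (Good : (exists v, l = bits v) -> bigstep (CCase r CSkip CFail (CPush r true)) s' Norm s' 4).
    { intros (v & ->). destruct (bits_msb v) as [Ev|(l0 & Ev)]; rewrite Ev in Er.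
      - eapply bs_weaken; [apply bs_case_nil; [exact Er|constructor]|lia].
      - rewrite rev_app_distr in Er. cbn in Er.
        eapply bs_eq; [eapply bs_case_cons with (k := 1); [exact Er|apply bs_push]|].
        rewrite upd_same, upd_upd, <- Er. apply upd_id. }
    destruct Dec as [(v & ->)|[(l0 & ->) NE]].
    + left. exists v, (upd s' r (rev (bits (S v)))). upd_lookup.
      rewrite enc_nat_bits. split; [exact E|].
      assert (LE := f_equal (@length bool) E).
      rewrite !length_app, length_tagged in LE. cbn in LE.
      assert (LI := length_incr (bits v)). rewrite <- bits_S in LI.
      split; [|split].
      * eapply bs_weaken.
        -- eapply bs_seq; [exact B1|]. eapply bs_seq; [eapply bs_seq|].
           ++ exact B2.
           ++ apply Good. eauto.
           ++ apply increment_correct; auto. rewrite E2. now upd_lookup.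
        -- lia.
      * rewrite E2 at 1. rewrite upd_upd. upd_ext.
      * split; [|split].
        -- upd_lookup. rewrite E2. now upd_lookup.
        -- upd_lookup. lia.
        -- intros q Hq. destruct (Nat.eq_dec q r) as [->|Dq]; upd_lookup.
           ++ rewrite length_rev. lia.
           ++ rewrite E2. upd_lookup. auto.
    + right. exists (upd s' r (rev l0)). split.
      * eapply bs_weaken; [eapply bs_seq; [exact B1|]|].
        -- apply bs_seq_exit; [|discriminate]. eapply bs_seq; [exact B2|].
           eapply bs_case_cons; [rewrite Er, rev_app_distr; reflexivity|constructor].
        -- lia.
      * intros v l. rewrite E, enc_nat_bits, <- !app_assoc. cbn [app]. intros E'.
        apply (tagged_false_inj (l0 ++ [false])) in E' as [E' _].
        now apply (NE v).
  - right. exists s'. split.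
    + eapply bs_weaken; [eapply bs_seq; [exact B1|]|].
      * apply bs_seq_exit; [|discriminate]. apply bs_seq_exit; [exact B2|discriminate].
      * lia.
    + intros v l. rewrite enc_nat_bits. specialize (F (bits v) l). now rewrite upd_other in F by auto.
Qed.

Fixpoint expect (l : list bool) : cmd :=
  match l with
  | [] => CSkip
  | b :: l' => CSeq (CCase 0 CFail (if b then CFail else CSkip) (if b then CSkip else CFail)) (expect l')
  end.

(** A fixed word is regarded as the code of the only element of [unit], so that it fits into
    [parses_seq]. *)
Lemma expect_correct l : forall s,
  parses (expect l) s (fun _ : unit => l) (fun _ s' => s' = upd s 0 (s' 0)) (5 * length l).
Proof.
  induction l as [|b l IH]; intros s.
  - left. exists tt, s. repeat split; [constructor|now rewrite upd_id].
  - cbn [expect length]. destruct (s 0) as [|b' l0] eqn:E0.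
    { right. exists s. split; [|now rewrite E0].
      eapply bs_weaken; [apply bs_seq_exit; [apply bs_case_nil; [auto|constructor]|discriminate]|lia]. }
    destruct (Bool.bool_dec b' b) as [->|Db].
    + assert (B1 : bigstep (CCase 0 CFail (if b then CFail else CSkip) (if b then CSkip else CFail))
                     s Norm (upd s 0 l0) 3).
      { apply (bs_case_cons _ _ _ _ b l0 _ _ _ 0); auto. destruct b; constructor. }
      destruct (IH (upd s 0 l0)) as [(u & s' & E & B & E')|(s' & B & F)].
      * left. exists u, s'. rewrite upd_same in E. rewrite upd_upd in E'.
        rewrite E0, E. split; auto. split; auto.
        eapply bs_weaken; [eapply bs_seq; [exact B1|exact B]|lia].
      * right. exists s'. split.
        -- eapply bs_weaken; [eapply bs_seq; [exact B1|exact B]|lia].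
        -- intros u l1. rewrite E0. intros [= E]. apply (F tt l1). now rewrite upd_same.
    + right. exists (upd s 0 l0). split.
      * eapply bs_weaken; [apply bs_seq_exit; [|discriminate]|].
        -- eapply bs_case_cons with (k := 2); [exact E0|].
           destruct b', b; try congruence; constructor.
        -- lia.
      * intros u l1. rewrite E0. intros [= -> _]. congruence.
Qed.

(** * Recognising and translating the source constraints *)

Definition vx (v : nat) : nat := tag false false (S v).
Definition vz (v : nat) : nat := tag true false (S v).
Definition vw (v : nat) : nat := tag false true (S v).

(** Well-formedness over [Gamma0] without the range condition on variables: exactly what the machine
    verifies. *)
Inductive in_Gamma0 : nat * list nat -> Prop :=
  | in_Gamma0_0 a b c : in_Gamma0 (0, [a; b; c])
  | in_Gamma0_1 a b c : in_Gamma0 (1, [a; b; c])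
  | in_Gamma0_2 a : in_Gamma0 (2, [a])
  | in_Gamma0_3 a : in_Gamma0 (3, [a]).

Definition translate (c : nat * list nat) : nat * list nat :=
  match c with
  | (0, [a; b; c]) => (0, [vx a; vx b; vz c])
  | (1, [a; b; c]) => (0, [vx a; vx b; vw c])
  | (2, [a]) => (0, [vx a; 0; 2])
  | (3, [a]) => (0, [vx a; 1; 2])
  | _ => c
  end.

(** During the parsing of constraints, registers 6 and 7 already hold the variable count for the
    later loops, and 8 has to stay empty. *)
Definition same_counters (s s' : state) : Prop := s' 6 = s 6 /\ s' 7 = s 7 /\ s' 8 = s 8.

Definition emitted (B : nat) (s : state) (c : nat * list nat) (s' : state) : Prop :=
  s' 1 = enc_constr c ++ s 1 /\ bounded B s' /\ same_counters s s'.

Definition ternary (b0 b1 : bool) : cmd :=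
  CSeq (CSeq (read 4) (CSeq (read 5) (read 2)))
       (emit (SR 4 false false, SR 5 false false, SR 2 b0 b1)).

Definition unary (c : nat) : cmd :=
  CSeq (read 4) (emit (SR 4 false false, SC c, SC 2)).

Lemma bounded_length B (s : state) r :
  bounded B s -> r = 2 \/ r = 4 \/ r = 5 -> length (s r) <= B + 1.
Proof. intros (_ & _ & H). auto. Qed.

Lemma bounded_output B s l : bounded B s -> bounded B (upd s 1 l).
Proof.
  intros (E & L & H). split; [|split]; try (now upd_lookup).
  intros r Hr. rewrite upd_other by lia. auto.
Qed.

(** The factor 231 is [3 * 60 + 51]: three variables are read and one constraint is written. *)
Lemma ternary_correct B b0 b1 s : bounded B s ->
  parses (ternary b0 b1) s
    (fun p => enc_nat (fst p) ++ enc_nat (fst (snd p)) ++ enc_nat (snd (snd p)))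
    (fun p => emitted B s (0, [vx (fst p); vx (fst (snd p)); tag b0 b1 (S (snd (snd p)))]))
    (231 * (B + 2)).
Proof.
  intros HB.
  assert (P : parses (CSeq (read 4) (CSeq (read 5) (read 2))) s
    (fun p => enc_nat (fst p) ++ enc_nat (fst (snd p)) ++ enc_nat (snd (snd p)))
    (fun p s' => bounded B s' /\ s' 4 = rev (bits (S (fst p))) /\
       s' 5 = rev (bits (S (fst (snd p)))) /\ s' 2 = rev (bits (S (snd (snd p)))) /\
       s' 1 = s 1 /\ same_counters s s') (60 * (B + 1) + (60 * (B + 1) + 60 * (B + 1)))).
  { eapply (parses_seq _ _ _ _ _ enc_nat (fun q => enc_nat (fst q) ++ enc_nat (snd q)));
      [apply enc_nat_inj|apply read_correct with (B := B); auto|].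
    intros a s1 [E1 B1].
    eapply (parses_seq _ _ _ _ _ enc_nat enc_nat); [apply enc_nat_inj|apply read_correct with (B := B); auto|].
    intros b s2 [E2 B2].
    destruct (read_correct 2 B s2 ltac:(auto) B2) as [(c & s3 & E & R & E3 & B3)|F]; [left|right; auto].
    exists c, s3. split; auto. split; auto. cbn [fst snd]. split; auto.
    unfold same_counters. rewrite E3. upd_lookup. rewrite E2. upd_lookup. rewrite E1. now upd_lookup. }
  destruct (parses_then _ _ (emit (SR 4 false false, SR 5 false false, SR 2 b0 b1)) _ _ _
    (fun p => emitted B s (0, [vx (fst p); vx (fst (snd p)); tag b0 b1 (S (snd (snd p)))]))
    _ (51 * (B + 1 + 1)) P) as [(a & s' & E & R & Q)|(s' & R & F)].
  - intros [a [b c]] s' (B' & E4 & E5 & E2 & E1 & S'). cbn [fst snd] in *.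
    (* The successors come from [read] and provide the positivity required by [slot_ok]. *)
    set (rho := fun r => match r with 4 => S a | 5 => S b | _ => S c end).
    eexists. split.
    { apply (emit_correct rho (B + 1)); [apply B'|].
      assert (L := fun r => bounded_length B s' r B').
      repeat split; auto; cbn; auto; lia. }
    split; [now upd_lookup|]. split; [upd_lookup; rewrite E1; reflexivity|].
    split; [now apply bounded_output|]. unfold same_counters. now upd_lookup.
  - left. exists a, s'. split; auto. split; auto. eapply bs_weaken; [exact R|lia].
  - right. exists s'. split; auto. eapply bs_weaken; [exact R|lia].
Qed.

Lemma unary_correct B c s : c < 4 -> bounded B s ->
  parses (unary c) s enc_nat (fun a => emitted B s (0, [vx a; c; 2])) (231 * (B + 2)).
Proof.
  intros Hc HB.
  destruct (parses_then _ _ (emit (SR 4 false false, SC c, SC 2)) _ _ _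
    (fun a => emitted B s (0, [vx a; c; 2]))
    _ (51 * (B + 1 + 1)) (read_correct 4 B s ltac:(auto) HB)) as [(a & s' & E & R & Q)|(s' & R & F)].
  - intros a s' (E' & B').
    eexists. split.
    { apply (emit_correct (fun _ => S a) (B + 1)); [apply B'|].
      assert (L := fun r => bounded_length B s' r B').
      cbn; repeat split; auto; try lia. rewrite E'. now upd_lookup. }
    split; [now upd_lookup|]. split; [upd_lookup; rewrite E'; now upd_lookup|].
    split; [now apply bounded_output|]. unfold same_counters. upd_lookup.
    rewrite E'. now upd_lookup.
  - left. exists a, s'. split; auto. split; auto. eapply bs_weaken; [exact R|lia].
  - right. exists s'. split; auto. eapply bs_weaken; [exact R|lia].
Qed.

(* [expect] receives what remains of the codes of relation index and arity. *)
Definition constraint_step : cmd :=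
  CCase 0 CBreak
    (CSeq (expect [true; true; true; true; false]) (ternary true false))
    (CCase 0 CFail
      (CSeq (expect [true; true; false; true; true; false]) (unary 0))
      (CCase 0 CFail
        (CSeq (expect [true; true; true; true; false]) (ternary false true))
        (CSeq (expect [true; false; true; true; false]) (unary 1)))).

Lemma bounded_input B s l : bounded B s -> length l <= B -> bounded B (upd s 0 l).
Proof.
  intros (E & _ & H) L. split; [|split]; try (now upd_lookup).
  intros r Hr. rewrite upd_other by lia. auto.
Qed.

Lemma expect_then_correct A B w c s (enc : A -> list bool) (cs : A -> nat * list nat) k :
  bounded B s ->
  (forall s', bounded B s' -> parses c s' enc (fun a => emitted B s' (cs a)) k) ->
  (exists a s', s 0 = w ++ enc a ++ s' 0 /\
     bigstep (CSeq (expect w) c) s Norm s' (5 * length w + k) /\ emitted B s (cs a) s') \/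
  (exists s', bigstep (CSeq (expect w) c) s Failed s' (5 * length w + k) /\
     forall a l, s 0 <> w ++ enc a ++ l).
Proof.
  intros HB Hc.
  destruct (parses_seq _ _ (expect w) c s (fun _ : unit => w) enc
    (fun _ s' => bounded B s' /\ s' = upd s 0 (s' 0))
    (fun p => emitted B s (cs (snd p))) (5 * length w) k) as [([u a] & s' & E & R & Q)|(s' & R & F)].
  - intros [] [] l l' E. now apply app_inv_head in E.
  - destruct (expect_correct w s) as [(u & s' & E & R & E')|F]; [left|right; auto].
    exists u, s'. split; auto. split; auto. split; auto.
    rewrite E'. apply bounded_input; auto.
    destruct HB as (_ & L & _). apply (f_equal (@length bool)) in E.
    rewrite length_app in E. lia.
  - intros u s' [B' E'].
    destruct (Hc s' B') as [(a & s2 & E & R & Q1 & Q2 & Q3)|F]; [left|right; auto].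
    exists a, s2. split; auto. split; auto. cbn [snd].
    split; [rewrite Q1, E'; now upd_lookup|]. split; auto.
    revert Q3. unfold same_counters. rewrite E'. now upd_lookup.
  - left. exists a, s'. cbn in E. rewrite <- app_assoc in E. auto.
  - right. exists s'. split; auto. intros a l. specialize (F (tt, a) l). cbn in F.
    now rewrite <- app_assoc in F.
Qed.

Lemma bounded_pop B s b l : bounded B s -> s 0 = b :: l -> bounded B (upd s 0 l).
Proof.
  intros HB E. apply bounded_input; auto. destruct HB as (_ & L & _).
  rewrite E in L. cbn in L. lia.
Qed.

Lemma emitted_input B s l c s' : emitted B (upd s 0 l) c s' -> emitted B s c s'.
Proof. unfold emitted, same_counters. now upd_lookup. Qed.

(** Here [pre] is the part of the constraint code that has been consumed already and is remembered
    only by the position in the program. *)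
Definition decided (B : nat) (pre : list bool) (c : cmd) (s : state) (k : nat) : Prop :=
  (exists d s', in_Gamma0 d /\ pre ++ s 0 = enc_constr d ++ s' 0 /\
     bigstep c s Norm s' k /\ emitted B s (translate d) s') \/
  (exists s', bigstep c s Failed s' k /\
     forall d l, in_Gamma0 d -> pre ++ s 0 <> enc_constr d ++ l).

(** Since [pre] contains no complete code, the end of the input is an error here. Only at the root
    does it mean the end of the constraint list, whence the alternative [s 0 <> []]. *)
Lemma decided_case B pre ce cf ct s k :
  ce = CFail \/ s 0 <> [] -> bounded B s -> (forall d l, in_Gamma0 d -> pre <> enc_constr d ++ l) ->
  (forall s', bounded B s' -> decided B (pre ++ [false]) cf s' k) ->
  (forall s', bounded B s' -> decided B (pre ++ [true]) ct s' k) ->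
  decided B pre (CCase 0 ce cf ct) s (k + 5).
Proof.
  intros Hce HB NE Hf Ht. destruct (s 0) as [|b l] eqn:E.
  - destruct Hce as [->|]; [|easy]. right. exists s. rewrite E, app_nil_r. split; auto.
    eapply bs_weaken; [apply bs_case_nil; [auto|constructor]|lia].
  - assert (H : decided B (pre ++ [b]) (if b then ct else cf) (upd s 0 l) k).
    { destruct b; [apply Ht|apply Hf]; eauto using bounded_pop. }
    unfold decided in *. rewrite upd_same, <- app_assoc in H. rewrite E.
    destruct H as [(d & s' & G & E' & R & Q)|(s' & R & F)].
    + left. exists d, s'. split; auto. split; auto. split; [|eauto using emitted_input].
      eapply bs_weaken; [eapply bs_case_cons; eauto|lia].
    + right. exists s'. split; auto.
      eapply bs_weaken; [eapply bs_case_cons; eauto|lia].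
Qed.

(** At a leaf the consumed prefix determines the relation: the word [w] completes index and arity,
    and only the scope, coded by [enc], remains open. *)
Lemma decided_leaf A B pre w c s (enc : A -> list bool) (cs cs' : A -> nat * list nat) k :
  bounded B s ->
  (forall s', bounded B s' -> parses c s' enc (fun a => emitted B s' (cs' a)) k) ->
  (forall a, in_Gamma0 (cs a) /\ cs' a = translate (cs a) /\
     forall l, pre ++ w ++ enc a ++ l = enc_constr (cs a) ++ l) ->
  (forall d l l', in_Gamma0 d -> pre ++ l' = enc_constr d ++ l -> exists a, d = cs a) ->
  decided B pre (CSeq (expect w) c) s (5 * length w + k).
Proof.
  intros HB Hc Hcs Hd.
  destruct (expect_then_correct A B w c s enc cs' k HB Hc) as [(a & s' & E & R & Q)|(s' & R & F)].
  - left. destruct (Hcs a) as (G & T & Ea). exists (cs a), s'. rewrite E, Ea, <- T. auto.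
  - right. exists s'. split; auto. intros d l G E.
    destruct (Hd _ _ _ G E) as [a ->]. destruct (Hcs a) as (_ & _ & Ea).
    rewrite <- Ea in E. apply app_inv_head in E. now apply F in E.
Qed.

Lemma decided_weaken B pre c s k k' : decided B pre c s k -> k <= k' -> decided B pre c s k'.
Proof.
  intros [(d & s' & G & E & R & Q)|(s' & R & F)] L; [left; exists d, s'|right; exists s'];
    eauto 6 using bs_weaken.
Qed.

(** The code of index 0 is [false], that of 2 starts with [true false], that of 1 is
    [true true false], and that of 3 starts with [true true true]; hence at most three bits select
    the relation. *)
Lemma constraint_step_correct B s : bounded B s -> s 0 <> [] ->
  decided B [] constraint_step s (231 * (B + 2) + 43).
Proof.
  intros HB NE.
  assert (T := fun b0 b1 s' HB' => ternary_correct B b0 b1 s' HB').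
  assert (U := fun c H s' HB' => unary_correct B c s' H HB').
  replace (231 * (B + 2) + 43) with (231 * (B + 2) + 38 + 5) by lia.
  apply decided_case; auto.
  { intros d l []; discriminate. }
  { intros s1 H1. eapply decided_weaken.
    - apply (decided_leaf _ _ _ _ _ _ _ (fun p => (0, [fst p; fst (snd p); snd (snd p)])) _ _ H1 (T _ _)).
      + intros [a [b c]]. split; [constructor|]. split; [reflexivity|]. intros l.
        cbn. now rewrite app_nil_r, <- !app_assoc.
      + intros d l l' [a b c| | |] E; try discriminate. now exists (a, (b, c)).
    - cbn [length]. lia. }
  intros s1 H1. replace (231 * (B + 2) + 38) with (231 * (B + 2) + 33 + 5) by lia.
  apply decided_case; auto.
  { intros d l []; discriminate. }
  { intros s2 H2. eapply decided_weaken.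
    - apply (decided_leaf _ _ _ _ _ _ _ (fun a => (2, [a])) _ _ H2 (U 0 ltac:(lia))).
      + intros a. split; [constructor|]. split; [reflexivity|]. intros l.
        cbn. now rewrite app_nil_r.
      + intros d l l' [| |a|] E; try discriminate. now exists a.
    - cbn [length]. lia. }
  intros s2 H2. replace (231 * (B + 2) + 33) with (231 * (B + 2) + 28 + 5) by lia.
  apply decided_case; auto.
  { intros d l []; discriminate. }
  { intros s3 H3. eapply decided_weaken.
    - apply (decided_leaf _ _ _ _ _ _ _ (fun p => (1, [fst p; fst (snd p); snd (snd p)])) _ _ H3 (T _ _)).
      + intros [a [b c]]. split; [constructor|]. split; [reflexivity|]. intros l.
        cbn. now rewrite app_nil_r, <- !app_assoc.
      + intros d l l' [|a b c| |] E; try discriminate. now exists (a, (b, c)).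
    - cbn [length]. lia. }
  intros s3 H3. eapply decided_weaken.
  - apply (decided_leaf _ _ _ _ _ _ _ (fun a => (3, [a])) _ _ H3 (U 1 ltac:(lia))).
    + intros a. split; [constructor|]. split; [reflexivity|]. intros l.
      cbn. now rewrite app_nil_r.
    + intros d l l' [| | |a] E; try discriminate. now exists a.
  - cbn [length]. lia.
Qed.

(** The induction runs over the length [n] of the remaining input, while [B] stays fixed and bounds
    the cost of a single round. Codes of constraints are nonempty, so every round shortens the
    input. *)
Lemma parse_constraints_correct B n : forall s, bounded B s -> length (s 0) <= n ->
  (exists cs s', Forall in_Gamma0 cs /\ s 0 = enc_constrs cs /\
     bigstep (CRepeat constraint_step) s Norm s' ((231 * (B + 2) + 45) * n + 5) /\
     s' 1 = enc_constrs (rev (map translate cs)) ++ s 1 /\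
     bounded B s' /\ same_counters s s') \/
  (exists s', bigstep (CRepeat constraint_step) s Failed s' ((231 * (B + 2) + 45) * n + 5) /\
     forall cs, Forall in_Gamma0 cs -> s 0 <> enc_constrs cs).
Proof.
  induction n as [n IH] using lt_wf_ind. intros s HB L.
  destruct (list_eq_dec Bool.bool_dec (s 0) []) as [E0|NE].
  { left. exists [], s. repeat (split; auto).
    eapply bs_weaken; [apply bs_repeat_break, bs_case_nil; [auto|constructor]|lia]. }
  destruct (constraint_step_correct B s HB NE) as [(c & s1 & G & E & R & Q1 & Q2 & Q3)|(s' & R & F)];
    cbn [app] in *.
  - assert (LE : length (s1 0) < length (s 0)).
    { rewrite E, length_app. specialize (enc_constr_nonempty c []). rewrite app_nil_r.
      destruct (enc_constr c); [easy|cbn; lia]. }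
    destruct (IH (length (s1 0)) ltac:(lia) s1 Q2 (le_n _))
      as [(cs & s' & Gs & Es & R' & Q1' & Q2' & Q3')|(s' & R' & F)].
    + left. exists (c :: cs), s'. split; [auto|]. split; [cbn; congruence|].
      split; [|split; [|split]]; auto.
      * eapply bs_weaken; [eapply bs_repeat_next; [exact R|exact R']|nia].
      * rewrite Q1', Q1. cbn [map rev]. rewrite map_app, concat_app. cbn [map concat].
        now rewrite app_nil_r, <- app_assoc.
      * destruct Q3 as (? & ? & ?), Q3' as (? & ? & ?). repeat split; congruence.
    + right. exists s'. split.
      * eapply bs_weaken; [eapply bs_repeat_next; [exact R|exact R']|nia].
      * intros [|c' cs] Gs Es; [easy|]. inversion_clear Gs.
        rewrite E in Es. apply enc_constr_inj in Es as [_ Es]. now apply F in Es.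
  - right. exists s'. split.
    + eapply bs_weaken; [apply bs_repeat_fail; exact R|].
      destruct n; [|nia]. destruct (s 0); [easy|cbn in L; lia].
    + intros [|c cs] Gs Es; [easy|]. inversion_clear Gs. now apply F in Es.
Qed.

(** * The reduction program *)

(** Polymorphic because the same five constraints are needed for slots in the program, for vertices
    in the instance and for colours in the finite check. *)
Definition links {A} (p0 p1 : A) (s t : A * A * A) : list (A * A * A) :=
  let '(x, z, w) := s in
  let '(x', z', w') := t in
  [(p0, x, x'); (p0, z, z'); (p1, w, w'); (x, z, w'); (x, w, z')].

(* The triples for the constants 0 and 1, then those that tie the otherwise
   unused vertices: 3 becomes a copy of 0 and [tag true true] a copy of [x]. *)
Definition family {A} (const : nat -> A) (var : bool -> bool -> A) : list (A * A * A) :=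
  [(const 0, const 0, const 2); (const 1, const 2, const 1); (const 3, const 0, const 2);
   (var false false, var true false, var false true);
   (var true true, var true false, var false true)].

(** Every family contains the constant triples. Running over all ordered pairs of variables, equal
    ones included, therefore links any two triples, as soon as there is a variable. *)
Definition pair_slots : list slots :=
  flat_map (fun s => flat_map (links (SC 0) (SC 1) s) (family SC (SR 5))) (family SC (SR 4)).

Definition two_regs (i j r : nat) : nat := if Nat.eqb r 4 then i else j.

Definition pair_constrs (i j : nat) : list (nat * list nat) :=
  map (constr_of (two_regs i j)) pair_slots.

Lemma pair_slots_ok (P : slot -> Prop) :
  (forall c, c < 4 -> P (SC c)) -> (forall r b0 b1, r = 4 \/ r = 5 -> P (SR r b0 b1)) ->
  Forall (fun t => let '(x, y, z) := t in P x /\ P y /\ P z) pair_slots.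
Proof.
  intros HC HR.
  assert (F : forall r t, r = 4 \/ r = 5 -> In t (family SC (SR r)) ->
    let '(x, y, z) := t in P x /\ P y /\ P z).
  { intros r t Hr. cbn.
    intros [<-|[<-|[<-|[<-|[<-|[]]]]]]; repeat split; auto; apply HC; lia. }
  apply Forall_forall. intros t Ht. unfold pair_slots in Ht.
  apply in_flat_map in Ht as (s & Hs & Ht). apply in_flat_map in Ht as (s' & Hs' & Ht).
  apply F in Hs, Hs'; auto. destruct s as [[x z] w], s' as [[x' z'] w'].
  destruct Hs as (? & ? & ?), Hs' as (? & ? & ?).
  assert (P (SC 0)) by (apply HC; lia). assert (P (SC 1)) by (apply HC; lia).
  cbn in Ht. destruct Ht as [<-|[<-|[<-|[<-|[<-|[]]]]]]; auto.
Qed.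

(** While register 7 is counted down, register 8 is counted up, so that the outer loop can restore
    the counter. *)
Definition inner_loop : cmd :=
  while 7 CSkip (CSeq (CPush 8 true) (CSeq (increment 5) (emits pair_slots))).

Definition pair_cost : nat := 75 + 51 * length pair_slots.

Lemma inner_loop_correct B i k : forall j s,
  s 3 = [] -> s 4 = rev (bits i) -> 0 < i <= B -> s 5 = rev (bits j) ->
  s 7 = repeat true k -> j + k <= B ->
  exists s', bigstep inner_loop s Norm s' (pair_cost * (B + 1) * k + 5) /\
    s' 1 = enc_constrs (rev (flat_map (pair_constrs i) (seq (S j) k))) ++ s 1 /\
    s' 3 = [] /\ s' 4 = s 4 /\ s' 5 = rev (bits (j + k)) /\ s' 6 = s 6 /\
    s' 7 = [] /\ s' 8 = repeat true k ++ s 8.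
Proof.
  induction k as [|k IH]; intros j s E3 E4 Hi E5 E7 L.
  - exists s. rewrite Nat.add_0_r. repeat (split; auto).
    rewrite Nat.mul_0_r. now apply while_nil.
  - cbn [repeat] in E7.
    set (s1 := upd (upd (upd s 7 (repeat true k)) 8 (true :: s 8)) 5 (rev (bits (S j)))).
    set (s2 := upd s1 1 (enc_constrs (rev (pair_constrs i (S j))) ++ s 1)).
    assert (R : bigstep (CSeq (CPush 8 true) (CSeq (increment 5) (emits pair_slots)))
      (upd s 7 (repeat true k)) Norm s2
      (1 + ((18 * length (bits j) + 22) + 51 * (B + 1) * length pair_slots))).
    { eapply bs_seq; [eapply bs_eq; [apply bs_push|reflexivity]|].
      eapply bs_seq.
      - eapply bs_eq; [apply increment_correct; [lia|now upd_lookup|now upd_lookup]|].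
        reflexivity.
      - apply (emits_correct (two_regs i (S j)) B pair_slots s1).
        + subst s1. now upd_lookup.
        + apply (pair_slots_ok (slot_ok (two_regs i (S j)) B s1)); cbn; auto.
          intros r b0 b1 Hr. subst s1.
          assert (Lb := length_bits i). assert (Lb' := length_bits (S j)).
          destruct Hr as [-> | ->]; upd_lookup; rewrite ?E4, length_rev; cbn [two_regs Nat.eqb];
            unfold two_regs; cbn [Nat.eqb]; repeat split; auto; lia. }
    destruct (IH (S j) s2) as (s' & R' & Q1 & Q3 & Q4 & Q5 & Q6 & Q7 & Q8);
      try (subst s2 s1; now upd_lookup); try lia.
    exists s'. split; [|split; [|split; [|split; [|split; [|split; [|split]]]]]]; auto.
    + assert (Lb := length_bits j). unfold pair_cost in *. eapply bs_weaken.
      * eapply while_cons; [exact E7|exact R|exact R'].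
      * nia.
    + rewrite Q1. subst s2 s1. upd_lookup. cbn [seq flat_map].
      now rewrite rev_app_distr, map_app, concat_app, <- app_assoc.
    + rewrite Q5. now rewrite Nat.add_succ_r.
    + rewrite Q8. subst s2 s1. upd_lookup. cbn [repeat].
      now rewrite (repeat_cons k true), <- app_assoc.
Qed.

Definition outer_loop : cmd :=
  while 6 CSkip (CSeq (increment 4) (CSeq (clear 5) (CSeq inner_loop (move 8 7)))).

Lemma outer_loop_correct B n k : forall i s,
  n <= B -> i + k = n -> s 3 = [] -> s 4 = rev (bits i) -> length (s 5) <= B + 1 ->
  s 6 = repeat true k -> s 7 = repeat true n -> s 8 = [] ->
  exists s', bigstep outer_loop s Norm s' ((pair_cost + 70) * (B + 1) * (B + 1) * k + 5) /\
    s' 1 = enc_constrs (rev (flat_map (fun i => flat_map (pair_constrs i) (seq 1 n)) (seq (S i) k)))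
           ++ s 1 /\
    s' 7 = repeat true n.
Proof.
  induction k as [|k IH]; intros i s L Ei E3 E4 E5 E6 E7 E8.
  - exists s. rewrite Nat.mul_0_r. repeat (split; auto). now apply while_nil.
  - cbn [repeat] in E6.
    set (s1 := upd (upd s 6 (repeat true k)) 4 (rev (bits (S i)))).
    (* The empty register represents 0, so clearing register 5 restarts the inner index. *)
    destruct (inner_loop_correct B (S i) n 0 (upd s1 5 []))
      as (s2 & R2 & Q1 & Q3 & Q4 & Q5 & Q6 & Q7 & Q8);
      try (subst s1; now upd_lookup); try lia.
    assert (R3 := move_correct 8 7 s2 ltac:(lia)).
    rewrite Q7, Q8, app_nil_r in R3. revert R3. subst s1. upd_lookup. intros R3.
    rewrite E8, app_nil_r, rev_repeat, repeat_length in R3.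
    set (s3 := upd (upd s2 8 []) 7 (repeat true n)) in *.
    destruct (IH (S i) s3) as (s' & R' & P1 & P7); subst s3; try (now upd_lookup); try lia.
    + upd_lookup. rewrite Q5, length_rev. assert (Lb := length_bits (0 + n)). lia.
    + exists s'. split; [|split]; auto.
      * assert (Lb := length_bits i).
        eapply bs_weaken.
        -- eapply while_cons; [exact E6| |exact R'].
           eapply bs_seq; [apply (increment_correct 4 _ i); [lia|now upd_lookup|now upd_lookup]|].
           eapply bs_seq; [apply clear_correct|].
           eapply bs_seq; [exact R2|exact R3].
        -- upd_lookup.
           assert (pair_cost * (B + 1) * n <= pair_cost * (B + 1) * (B + 1))
             by (apply Nat.mul_le_mono_l; lia).
           nia.
      * rewrite P1. upd_lookup. rewrite Q1. upd_lookup. cbn [seq flat_map].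
        now rewrite rev_app_distr, map_app, concat_app, <- app_assoc.
Qed.

(** Two copies of the count are made, one for each of the nested loops; the second is used once more
    by [write_count]. *)
Definition read_count : cmd :=
  CRepeat (CCase 0 CFail CBreak (CSeq (CPush 6 true) (CPush 7 true))).

Lemma read_count_correct l : forall s, s 0 = l ->
  parses read_count s (fun n => repeat true n ++ [false])
    (fun n s' => s' = upd (upd (upd s 0 (s' 0)) 6 (repeat true n ++ s 6))
                        7 (repeat true n ++ s 7)) (7 * length l + 5).
Proof.
  induction l as [|[] l IH]; intros s E.
  - right. exists s. split.
    + eapply bs_weaken; [apply bs_repeat_fail, bs_case_nil; [auto|constructor]|cbn; lia].
    + intros n l. rewrite E. now destruct n.
  - set (s1 := upd (upd (upd s 0 l) 6 (true :: s 6)) 7 (true :: s 7)).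
    assert (R1 : bigstep (CCase 0 CFail CBreak (CSeq (CPush 6 true) (CPush 7 true))) s Norm s1 5).
    { apply (bs_case_cons _ _ _ _ true l _ _ _ 2); auto.
      apply (bs_seq _ _ _ _ _ _ 1 1 (bs_push _ _ _)).
      eapply bs_eq; [apply bs_push|]. reflexivity. }
    destruct (IH s1) as [(n & s' & E0 & R & E')|(s' & R & F)].
    + reflexivity.
    + left. exists (S n), s'. split; [|split].
      * rewrite E. cbn. f_equal. exact E0.
      * eapply bs_weaken; [eapply bs_repeat_next; [exact R1|exact R]|cbn; lia].
      * rewrite E' at 1. subst s1. upd_lookup. cbn [repeat].
        rewrite (repeat_cons n true), <- !app_assoc. cbn [app]. upd_ext.
    + right. exists s'. split.
      * eapply bs_weaken; [eapply bs_repeat_next; [exact R1|exact R]|cbn; lia].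
      * intros [|n] l'; cbn; rewrite E; [discriminate|]. intros [= El].
        now apply (F n l').
  - left. exists 0, (upd s 0 l). upd_lookup. split; [auto|]. split.
    + eapply bs_weaken; [apply bs_repeat_break; eapply bs_case_cons; [exact E|constructor]|lia].
    + cbn [repeat app]. upd_ext.
Qed.

Definition write_count : cmd := while 7 CSkip (push_list [true; true; true; true]).

Lemma write_count_correct n : forall s, s 7 = repeat true n ->
  exists s', bigstep write_count s Norm s' (9 * n + 5) /\ s' 1 = repeat true (4 * n) ++ s 1.
Proof.
  induction n as [|n IH]; intros s E.
  - exists s. split; auto. now apply while_nil.
  - cbn [repeat] in E. assert (R := push_list_correct [true; true; true; true] (upd s 7 (repeat true n))).
    destruct (IH (upd (upd s 7 (repeat true n)) 1 ([true; true; true; true] ++ s 1))) as (s' & R' & Q).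
    { now upd_lookup. }
    exists s'. split.
    + eapply bs_weaken; [eapply while_cons; [exact E|exact R|exact R']|cbn; lia].
    + rewrite Q. upd_lookup. replace (4 * S n) with (4 * n + 4) by lia.
      now rewrite repeat_app, <- app_assoc.
Qed.

(** Back to front: translated constraints, linking constraints, the separator, then the unary count,
    four bits per variable and four more for the vertices below 4. *)
Definition reduction : cmd :=
  CSeq read_count
  (CSeq (CRepeat constraint_step)
  (CSeq (clear 4)
  (CSeq outer_loop
  (CSeq (CPush 1 false)
  (CSeq write_count (push_list [true; true; true; true])))))).

Definition reduce (I : instance) : instance :=
  Inst (4 * S (nvars I))
    (rev (map translate (constrs I) ++
          flat_map (fun i => flat_map (pair_constrs i) (seq 1 (nvars I))) (seq 1 (nvars I)))).

(** The coefficient of a cubic bound: there are at most quadratically many pairs of variables, each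
    handled in linear time. *)
Definition time_coeff : nat := pair_cost + 1000.

Lemma reduction_correct x :
  (exists I s, Forall in_Gamma0 (constrs I) /\ x = enc_instance I /\
     bigstep reduction (regs (init x)) Norm s (time_coeff * (length x + 1) ^ 3) /\
     s 1 = enc_instance (reduce I)) \/
  (exists s, bigstep reduction (regs (init x)) Failed s (time_coeff * (length x + 1) ^ 3) /\
     forall I, Forall in_Gamma0 (constrs I) -> x <> enc_instance I).
Proof.
  set (B := length x). set (s0 := regs (init x)).
  assert (T : forall a, a <= (pair_cost + 1000) * ((B + 1) * (B + 1) * (B + 1)) ->
    a <= time_coeff * (B + 1) ^ 3).
  { intros a Ha. unfold time_coeff. cbn [Nat.pow]. nia. }
  assert (B1 : 1 <= (B + 1) * (B + 1)) by nia.
  destruct (read_count_correct x s0 eq_refl) as [(n & s1 & E1 & R1 & E1')|(s1 & R1 & F)].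
  2: { right. exists s1. split.
       - eapply bs_weaken; [apply bs_seq_exit; [exact R1|discriminate]|]. apply T. fold B. nia.
       - intros I _ Ex. apply (F (nvars I) (enc_constrs (constrs I))).
         rewrite <- app_assoc. exact Ex. }
  change (s0 0) with x in E1. change (s0 6) with (@nil bool) in E1'.
  change (s0 7) with (@nil bool) in E1'. rewrite !app_nil_r in E1'.
  rewrite <- app_assoc in E1. cbn [app] in E1.
  assert (LE := f_equal (@length bool) E1).
  rewrite length_app, repeat_length in LE. cbn [length] in LE. fold B in LE.
  assert (B1' : bounded B s1).
  { split; [rewrite E1'; reflexivity|]. split; [lia|].
    intros r [-> | [-> | ->]]; rewrite E1'; cbn; lia. }
  destruct (parse_constraints_correct B B s1 B1' ltac:(lia))
    as [(cs & s2 & G & E2 & R2 & Q1 & B2 & Q6 & Q7 & Q8)|(s2 & R2 & F)].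
  2: { right. exists s2. split.
       - eapply bs_weaken.
         + eapply bs_seq; [exact R1|]. apply bs_seq_exit; [exact R2|discriminate].
         + apply T. fold B. nia.
       - intros I G Ex. unfold enc_instance in Ex. rewrite E1 in Ex.
         apply unary_inj in Ex as [_ Ex]. now apply (F _ G). }
  left.
  rewrite E1' in Q1, Q6, Q7, Q8. cbn in Q1, Q6, Q7, Q8.
  assert (R3 := clear_correct 4 s2).
  destruct (outer_loop_correct B n n 0 (upd s2 4 [])) as (s4 & R4 & P1 & P7);
    try (now upd_lookup); try lia.
  { upd_lookup. apply B2. }
  { upd_lookup. apply B2. auto. }
  destruct (write_count_correct n (upd s4 1 (false :: s4 1))) as (s5 & R5 & P5).
  { now upd_lookup. }
  assert (R6 := push_list_correct [true; true; true; true] s5).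
  exists (Inst n cs), (upd s5 1 ([true; true; true; true] ++ s5 1)).
  split; [exact G|]. split; [|split].
  - unfold enc_instance. cbn [nvars constrs]. rewrite E1, E2. reflexivity.
  - eapply bs_weaken.
    + eapply bs_seq; [exact R1|]. eapply bs_seq; [exact R2|]. eapply bs_seq; [exact R3|].
      eapply bs_seq; [exact R4|]. eapply bs_seq; [apply bs_push|].
      eapply bs_seq; [exact R5|exact R6].
    + apply T. fold B.
      assert (L4 := bounded_length B s2 4 B2 ltac:(auto)).
      assert ((pair_cost + 70) * (B + 1) * (B + 1) * n
              <= (pair_cost + 70) * ((B + 1) * (B + 1) * (B + 1))).
      { rewrite <- !Nat.mul_assoc. repeat apply Nat.mul_le_mono_l. lia. }
      cbn [length]. nia.
  - upd_lookup. rewrite P5. upd_lookup. rewrite P1. upd_lookup. rewrite Q1, app_nil_r.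
    unfold enc_instance, reduce. cbn [nvars constrs].
    rewrite rev_app_distr, map_app, concat_app.
    replace (4 * S n) with (4 + 4 * n) by lia. rewrite repeat_app, <- app_assoc. reflexivity.
Qed.

(** * No-rainbow colourings *)

Definition eqb3 (a b : three) : bool :=
  match a, b with t0, t0 | t1, t1 | t2, t2 => true | _, _ => false end.

(** Three values miss one of the three colours exactly when two of them coincide. *)
Definition nr (a b c : three) : bool := (eqb3 a b || eqb3 b c || eqb3 a c)%bool.

Lemma nr_spec a b c : holds Nrel [a; b; c] <-> nr a b c = true.
Proof.
  cbn. split.
  - intros H. destruct a, b, c; try reflexivity;
      exfalso; apply H; intros []; auto.
  - intros E H. specialize (H t0) as H0. specialize (H t1) as H1. specialize (H t2) as H2.
    destruct a, b, c; try discriminate; intuition discriminate.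
Qed.

Lemma eqb3_spec a b : eqb3 a b = true <-> a = b.
Proof. destruct a, b; split; (reflexivity || discriminate). Qed.

Definition xcol (p0 p1 p2 : three) (b : bool) : three := if b then p1 else p0.
Definition zcol (p0 p1 p2 : three) (b : bool) : three := if b then p2 else p0.
Definition wcol (p0 p1 p2 : three) (b : bool) : three := if b then p1 else p2.

Notation triple := (three * three * three)%type.

Definition value_triple (p0 p1 p2 : three) (b : bool) : triple :=
  (xcol p0 p1 p2 b, zcol p0 p1 p2 b, wcol p0 p1 p2 b).

Definition compatible (p0 p1 : three) (s t : triple) : bool :=
  forallb (fun '(a, b, c) => nr a b c) (links p0 p1 s t).

Definition mem3 (d : three) (s : triple) : bool :=
  let '(a, b, c) := s in (eqb3 d a || eqb3 d b || eqb3 d c)%bool.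

Definition colours : list three := [t0; t1; t2].
Definition triples : list triple := list_prod (list_prod colours colours) colours.

Lemma in_colours a : In a colours.
Proof. destruct a; cbn; auto. Qed.

Lemma in_triples s : In s triples.
Proof. destruct s as [[a b] c]. repeat apply in_prod; apply in_colours. Qed.

(** Every member of a linked family passes this filter, which keeps the search over three triples
    small. *)
Definition candidates (p0 p1 p2 : three) : list triple :=
  filter (fun s => forallb (fun b => (compatible p0 p1 s (value_triple p0 p1 p2 b) &&
                                      compatible p0 p1 (value_triple p0 p1 p2 b) s)%bool)
                     [false; true]) triples.

(** If the constants are not rainbow, no mutually compatible candidates [a], [b], [c] contain the
    colours [t0], [t1], [t2] respectively, which contradicts surjectivity; if they are rainbow, each
    candidate is one of the two intended triples. *)
Definition rainbow_check : bool :=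
  forallb (fun '(p0, p1, p2) =>
    if nr p0 p1 p2 then
      let l := candidates p0 p1 p2 in
      forallb (fun a => forallb (fun b => forallb (fun c =>
        if (mem3 t0 a && mem3 t1 b && mem3 t2 c)%bool then
          negb (forallb (fun s => forallb (compatible p0 p1 s) [a; b; c]) [a; b; c])
        else true) l) l) l
    else forallb (fun s => existsb (fun b =>
           let '(x, z, w) := s in
           let '(x', z', w') := value_triple p0 p1 p2 b in
           (eqb3 x x' && eqb3 z z' && eqb3 w w')%bool) [false; true]) (candidates p0 p1 p2)) triples.

Lemma rainbow_check_true : rainbow_check = true.
Proof. vm_compute. reflexivity. Qed.

Definition linked_family (p0 p1 p2 : three) (T : triple -> Prop) : Prop :=
  (forall b, T (value_triple p0 p1 p2 b)) /\
  forall s t, T s -> T t -> compatible p0 p1 s t = true.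

Lemma family_candidates p0 p1 p2 T s :
  linked_family p0 p1 p2 T -> T s -> In s (candidates p0 p1 p2).
Proof.
  intros [T_value T_compatible] H. apply filter_In. split; [apply in_triples|].
  cbn [forallb]. now rewrite !T_compatible by auto.
Qed.

Lemma surjective_rainbow p0 p1 p2 T :
  linked_family p0 p1 p2 T ->
  (forall d, exists s, T s /\ mem3 d s = true) -> nr p0 p1 p2 = false.
Proof.
  intros LF S. destruct (nr p0 p1 p2) eqn:N; auto.
  destruct (S t0) as (a & Ta & Ma), (S t1) as (b & Tb & Mb), (S t2) as (c & Tc & Mc).
  assert (C := rainbow_check_true). unfold rainbow_check in C.
  rewrite forallb_forall in C. specialize (C (p0, p1, p2) (in_triples _)). cbn beta iota in C.
  rewrite N in C. cbv zeta in C.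
  rewrite forallb_forall in C. specialize (C a (family_candidates _ _ _ T a LF Ta)).
  rewrite forallb_forall in C. specialize (C b (family_candidates _ _ _ T b LF Tb)).
  rewrite forallb_forall in C. specialize (C c (family_candidates _ _ _ T c LF Tc)).
  cbn [forallb] in C. rewrite Ma, Mb, Mc in C. cbn [andb] in C. rewrite !(proj2 LF) in C by auto. discriminate.
Qed.

Lemma rainbow_value p0 p1 p2 T s :
  linked_family p0 p1 p2 T -> nr p0 p1 p2 = false -> T s ->
  exists b, s = value_triple p0 p1 p2 b.
Proof.
  intros LF N Ts. assert (C := rainbow_check_true). unfold rainbow_check in C.
  rewrite forallb_forall in C. specialize (C (p0, p1, p2) (in_triples _)). cbn beta iota in C.
  rewrite N in C.
  rewrite forallb_forall in C. specialize (C s (family_candidates _ _ _ T s LF Ts)).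
  apply existsb_exists in C as (b & _ & C). exists b.
  destruct s as [[x z] w]. cbn in C.
  apply andb_prop in C as [C Cw]. apply andb_prop in C as [Cx Cz].
  apply eqb3_spec in Cx, Cz, Cw. unfold value_triple. congruence.
Qed.

Lemma value_compatible p0 p1 p2 a b : nr p0 p1 p2 = false ->
  compatible p0 p1 (value_triple p0 p1 p2 a) (value_triple p0 p1 p2 b) = true.
Proof. intros N. destruct p0, p1, p2; try discriminate; destruct a, b; reflexivity. Qed.

Lemma nr_value_xz p0 p1 p2 a b c : nr p0 p1 p2 = false ->
  nr (xcol p0 p1 p2 a) (xcol p0 p1 p2 b) (zcol p0 p1 p2 c) = true <-> a = b \/ c = false.
Proof.
  intros N. destruct p0, p1, p2; try discriminate; destruct a, b, c; cbn; intuition discriminate.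
Qed.

Lemma nr_value_xw p0 p1 p2 a b c : nr p0 p1 p2 = false ->
  nr (xcol p0 p1 p2 a) (xcol p0 p1 p2 b) (wcol p0 p1 p2 c) = true <-> a = b \/ c = true.
Proof.
  intros N. destruct p0, p1, p2; try discriminate; destruct a, b, c; cbn; intuition discriminate.
Qed.

Lemma nr_value_false p0 p1 p2 a : nr p0 p1 p2 = false ->
  nr (xcol p0 p1 p2 a) p0 p2 = true <-> a = false.
Proof. intros N. destruct p0, p1, p2; try discriminate; destruct a; cbn; intuition discriminate. Qed.

Lemma nr_value_true p0 p1 p2 a : nr p0 p1 p2 = false ->
  nr (xcol p0 p1 p2 a) p1 p2 = true <-> a = true.
Proof. intros N. destruct p0, p1, p2; try discriminate; destruct a; cbn; intuition discriminate. Qed.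

(** * Correctness of the reduction *)

Definition vertices (m : nat) : list (nat * nat * nat) :=
  family (fun c => c) (fun b0 b1 => tag b0 b1 m).

Lemma in_pair_constrs i j c : In c (pair_constrs i j) <->
  exists s t x y z, In s (vertices i) /\ In t (vertices j) /\
    In (x, y, z) (links 0 1 s t) /\ c = (0, [x; y; z]).
Proof.
  (* Evaluating the slots under [two_regs] turns both sides into the same explicit list. *)
  replace (pair_constrs i j) with
    (flat_map (fun s => flat_map (fun t =>
       map (fun '(x, y, z) => (0, [x; y; z])) (links 0 1 s t)) (vertices j)) (vertices i))
    by reflexivity.
  rewrite in_flat_map. split.
  - intros (s & Hs & H). apply in_flat_map in H as (t & Ht & H).
    apply in_map_iff in H as ([[x y] z] & <- & H). exists s, t, x, y, z. auto.
  - intros (s & t & x & y & z & Hs & Ht & H & ->). exists s. split; auto.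
    apply in_flat_map. exists t. split; auto.
    apply in_map_iff. now exists (x, y, z).
Qed.

Lemma in_reduce I c : In c (constrs (reduce I)) <->
  (exists d, In d (constrs I) /\ c = translate d) \/
  (exists i j, 1 <= i <= nvars I /\ 1 <= j <= nvars I /\ In c (pair_constrs i j)).
Proof.
  cbn [reduce constrs]. rewrite <- in_rev, in_app_iff, in_map_iff, in_flat_map.
  split; (intros [H|H]; [left|right]).
  - destruct H as (d & <- & H). eauto.
  - destruct H as (i & Hi & H). apply in_flat_map in H as (j & Hj & H).
    apply in_seq in Hi, Hj. exists i, j. repeat split; auto; lia.
  - destruct H as (d & H & ->). eauto.
  - destruct H as (i & j & Hi & Hj & H). exists i. split; [apply in_seq; lia|].
    apply in_flat_map. exists j. split; auto. apply in_seq; lia.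
Qed.

Definition sat_constr (col : nat -> three) (c : nat * list nat) : Prop :=
  exists R, nth_error LangN (fst c) = Some R /\ holds R (map col (snd c)).

Lemma sat_constr_N col x y z :
  sat_constr col (0, [x; y; z]) <-> nr (col x) (col y) (col z) = true.
Proof.
  rewrite <- nr_spec. split.
  - intros (R & [= <-] & H). exact H.
  - intros H. exists Nrel. auto.
Qed.

Lemma wf_constr_N n x y z :
  (exists R, nth_error LangN 0 = Some R /\ length [x; y; z] = arity R /\
     forall v, In v [x; y; z] -> v < n) <-> x < n /\ y < n /\ z < n.
Proof.
  split.
  - intros (R & _ & _ & H). cbn in H. auto 7.
  - intros (Hx & Hy & Hz). exists Nrel. repeat split; auto.
    intros v [<-|[<-|[<-|[]]]]; auto.
Qed.

Lemma wf_in_Gamma0 I : wf_instance Gamma0 I -> Forall in_Gamma0 (constrs I).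
Proof.
  intros H. apply Forall_forall. intros [i l] Hc.
  destruct (H _ Hc) as (R & HR & Hl & _). cbn [fst snd] in *.
  destruct i as [|[|[|[|i]]]]; [..|now destruct i]; injection HR as <-; cbn in Hl;
    repeat (destruct l as [|? l]; try discriminate Hl); constructor.
Qed.

Lemma tag_lt b0 b1 m n : m < n -> tag b0 b1 m < 4 * n.
Proof. unfold tag. destruct b0, b1; cbn [Nat.b2n]; lia. Qed.

Lemma tag_lt_inv b0 b1 m n : tag b0 b1 m < 4 * n -> m < n.
Proof. unfold tag. lia. Qed.

Lemma vertices_lt m n x z w :
  0 < n -> m < n -> In (x, z, w) (vertices m) -> x < 4 * n /\ z < 4 * n /\ w < 4 * n.
Proof.
  intros Hn Hm. cbn. intros [E|[E|[E|[E|[E|[]]]]]]; injection E as <- <- <-;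
    repeat split; auto using tag_lt; lia.
Qed.

Lemma links_lt n s t x y z :
  (let '(a, b, c) := s in a < n /\ b < n /\ c < n) ->
  (let '(a, b, c) := t in a < n /\ b < n /\ c < n) -> 1 < n ->
  In (x, y, z) (links 0 1 s t) -> x < n /\ y < n /\ z < n.
Proof.
  destruct s as [[a b] c], t as [[a' b'] c']. intros (? & ? & ?) (? & ? & ?) ?. cbn.
  intros [E|[E|[E|[E|[E|[]]]]]]; injection E as <- <- <-; repeat split; auto; lia.
Qed.

Lemma reduce_wf I : wf_instance Gamma0 I -> wf_instance LangN (reduce I).
Proof.
  intros W c Hc. apply in_reduce in Hc as [(d & Hd & ->)|(i & j & Hi & Hj & Hc)].
  - destruct (W d Hd) as (R & HR & Hl & Hv). apply wf_in_Gamma0 in W.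
    rewrite Forall_forall in W. specialize (W d Hd).
    assert (V : forall b0 b1 v, In v (snd d) -> tag b0 b1 (S v) < 4 * S (nvars I)).
    { intros b0 b1 v H. apply tag_lt. apply Hv in H. lia. }
    destruct W; apply wf_constr_N; repeat split; try (apply V; cbn; auto); cbn [reduce nvars]; lia.
  - apply in_pair_constrs in Hc as ([[a b] d] & [[a' b'] d'] & x & y & z & Hs & Ht & H & ->).
    apply wf_constr_N. cbn [reduce nvars]. eapply links_lt; [..|exact H].
    + eapply vertices_lt; [| |exact Hs]; lia.
    + eapply vertices_lt; [| |exact Ht]; lia.
    + lia.
Qed.

(** The intended colouring with the constants coloured [t0], [t1], [t2]. Vertex 3 copies vertex 0,
    and residue 3 falls under the last case, copying the vertex [vx]. *)
Definition colouring (alpha : nat -> bool) (v : nat) : three :=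
  match v with
  | 0 | 3 => t0
  | 1 => t1
  | 2 => t2
  | _ =>
      let b := alpha (v / 4 - 1) in
      match v mod 4 with
      | 1 => zcol t0 t1 t2 b
      | 2 => wcol t0 t1 t2 b
      | _ => xcol t0 t1 t2 b
      end
  end.

Lemma colouring_tag alpha b0 b1 m :
  colouring alpha (tag b0 b1 (S m)) =
  match b0, b1 with
  | true, false => zcol t0 t1 t2 (alpha m)
  | false, true => wcol t0 t1 t2 (alpha m)
  | _, _ => xcol t0 t1 t2 (alpha m)
  end.
Proof.
  assert (D : tag b0 b1 (S m) / 4 = S m).
  { symmetry. apply (Nat.div_unique _ _ _ (2 * Nat.b2n b1 + Nat.b2n b0)); [|reflexivity].
    destruct b0, b1; cbn; lia. }
  assert (M : tag b0 b1 (S m) mod 4 = 2 * Nat.b2n b1 + Nat.b2n b0).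
  { symmetry. apply (Nat.mod_unique _ _ (S m)); [|reflexivity].
    destruct b0, b1; cbn; lia. }
  assert (G : exists q, tag b0 b1 (S m) = 4 + q).
  { exists (4 * m + (2 * Nat.b2n b1 + Nat.b2n b0)). unfold tag. lia. }
  destruct G as [q Eq]. unfold colouring. rewrite Eq in *. cbn [Nat.add].
  change (S (S (S (S q)))) with (4 + q). rewrite D, M.
  replace (S m - 1) with m by lia. now destruct b0, b1.
Qed.

Definition map3 {A B} (f : A -> B) (t : A * A * A) : B * B * B :=
  let '(x, y, z) := t in (f x, f y, f z).

Lemma links_map {A B} (f : A -> B) p0 p1 s t :
  links (f p0) (f p1) (map3 f s) (map3 f t) = map (map3 f) (links p0 p1 s t).
Proof. now destruct s as [[x z] w], t as [[x' z'] w']. Qed.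

Lemma compatible_links col s t :
  compatible (col 0) (col 1) (map3 col s) (map3 col t) = true <->
  forall x y z, In (x, y, z) (links 0 1 s t) -> sat_constr col (0, [x; y; z]).
Proof.
  unfold compatible. rewrite links_map, forallb_forall. split.
  - intros H x y z Hin. apply sat_constr_N.
    apply (H (col x, col y, col z)). now apply (in_map (map3 col)) in Hin.
  - intros H t' Ht. apply in_map_iff in Ht as ([[x y] z] & <- & Hin). cbn.
    apply sat_constr_N. auto.
Qed.

Lemma colouring_vertices alpha m s : 1 <= m -> In s (vertices m) ->
  exists b, map3 (colouring alpha) s = value_triple t0 t1 t2 b.
Proof.
  destruct m as [|m]; [lia|]. intros _. unfold vertices, family. cbn [In].
  intros [<-|[<-|[<-|[<-|[<-|[]]]]]]; cbn [map3]; rewrite ?colouring_tag;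
    [exists false|exists true|exists false|exists (alpha m)|exists (alpha m)]; reflexivity.
Qed.

Lemma reduce_complete I alpha : wf_instance Gamma0 I -> satisfies Gamma0 I alpha ->
  satisfies LangN (reduce I) (colouring alpha).
Proof.
  intros W S c Hc. change (sat_constr (colouring alpha) c).
  apply in_reduce in Hc as [(d & Hd & ->)|(i & j & Hi & Hj & Hc)].
  - destruct (S d Hd) as (R & HR & H). apply wf_in_Gamma0 in W.
    rewrite Forall_forall in W. destruct (W d Hd) as [a b c|a b c|a|a];
      injection HR as <-; cbn in H; cbn [translate]; apply sat_constr_N;
      unfold vx, vz, vw; rewrite !colouring_tag.
    + now apply nr_value_xz.
    + now apply nr_value_xw.
    + now apply nr_value_false.
    + now apply nr_value_true.
  - apply in_pair_constrs in Hc as (s & t & x & y & z & Hs & Ht & H & ->).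
    revert H. apply compatible_links.
    destruct (colouring_vertices alpha i s ltac:(lia) Hs) as [a ->].
    destruct (colouring_vertices alpha j t ltac:(lia) Ht) as [b ->].
    now apply value_compatible.
Qed.

(** Ensures that a colour used anywhere is used within a triple, so that surjectivity on vertices
    carries over to the triples of the families. *)
Lemma vertex_cover n v : 1 <= n -> v < 4 * S n ->
  exists m s, 1 <= m <= n /\ In s (vertices m) /\
    forall f : nat -> three, mem3 (f v) (map3 f s) = true.
Proof.
  intros Hn Hv.
  assert (M : forall d x y z, d = x \/ d = y \/ d = z -> mem3 d (x, y, z) = true).
  { intros d x y z [-> | [-> | ->]]; cbn; rewrite !Bool.orb_true_iff, !eqb3_spec; auto. }
  destruct (le_lt_dec 4 v) as [L|L].
  - assert (D := Nat.div_mod_eq v 4). assert (R := Nat.mod_upper_bound v 4 ltac:(lia)).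
    generalize dependent (v mod 4). generalize dependent (v / 4). intros m r D R. exists m.
    assert (Hm : 1 <= m <= n) by lia.
    destruct r as [|[|[|[|]]]]; [| | | |lia].
    + exists (tag false false m, tag true false m, tag false true m).
      split; auto. split; [cbn; auto|]. intros f. apply M. left. f_equal. unfold tag. cbn. lia.
    + exists (tag false false m, tag true false m, tag false true m).
      split; auto. split; [cbn; auto|]. intros f. apply M. right; left. f_equal. unfold tag. cbn. lia.
    + exists (tag false false m, tag true false m, tag false true m).
      split; auto. split; [cbn; auto|]. intros f. apply M. right; right. f_equal. unfold tag. cbn. lia.
    + exists (tag true true m, tag true false m, tag false true m).
      split; auto. split; [cbn; auto 6|]. intros f. apply M. left. f_equal. unfold tag. cbn. lia.
  (* Vertices below 4 lie in constant triples, which belong to every family, in particular to that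
     of index 1. *)
  - exists 1. destruct v as [|[|[|[|]]]]; [| | | |lia].
    + exists (0, 0, 2). split; [lia|]. split; [cbn; auto|]. intros f. apply M. auto.
    + exists (1, 2, 1). split; [lia|]. split; [cbn; auto|]. intros f. apply M. auto.
    + exists (0, 0, 2). split; [lia|]. split; [cbn; auto|]. intros f. apply M. auto.
    + exists (3, 0, 2). split; [lia|]. split; [cbn; auto|]. intros f. apply M. auto.
Qed.

(** Each variable of a source constraint occurs as a vertex in its translation, and a vertex in
    range comes from a variable in range. Hence a variable out of range makes both instances
    ill-formed. *)
Lemma reduce_wf_inv I :
  Forall in_Gamma0 (constrs I) -> wf_instance LangN (reduce I) -> wf_instance Gamma0 I.
Proof.
  intros G W c Hc. rewrite Forall_forall in G. specialize (G c Hc).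
  assert (Hr : In (translate c) (constrs (reduce I))) by (apply in_reduce; eauto).
  specialize (W _ Hr).
  assert (V : forall b0 b1 v, tag b0 b1 (S v) < nvars (reduce I) -> v < nvars I).
  { intros b0 b1 v H. apply tag_lt_inv in H. lia. }
  destruct G as [a b c|a b c|a|a]; apply wf_constr_N in W as (Hx & Hy & Hz);
    eexists; (split; [reflexivity|split; [reflexivity|]]); cbn;
    intros v Hv; repeat (destruct Hv as [<-|Hv]); try easy; eapply V; eassumption.
Qed.

Lemma reduce_sound I col : wf_instance Gamma0 I -> satisfies LangN (reduce I) col ->
  (forall d, exists v, v < nvars (reduce I) /\ col v = d) ->
  exists alpha, satisfies Gamma0 I alpha.
Proof.
  intros W S Sur.
  (* Without variables nothing is linked, but there are no constraints either, since all relations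
     of [Gamma0] have positive arity. *)
  destruct (Nat.eq_dec (nvars I) 0) as [N0|N0].
  { exists (fun _ => false). intros c Hc. exfalso.
    destruct (W c Hc) as (R & _ & _ & Hv). rewrite N0 in Hv.
    apply wf_in_Gamma0 in W. rewrite Forall_forall in W.
    destruct (W c Hc) as [a b d|a b d|a|a]; specialize (Hv a (or_introl eq_refl)); lia. }
  set (T := fun s => exists m t, 1 <= m <= nvars I /\ In t (vertices m) /\ s = map3 col t).
  assert (TV : forall b, T (value_triple (col 0) (col 1) (col 2) b)).
  { intros b. exists 1, (if b then (1, 2, 1) else (0, 0, 2)).
    split; [lia|]. split; destruct b; cbn; auto. }
  assert (TC : forall s t, T s -> T t -> compatible (col 0) (col 1) s t = true).
  { intros s t (i & s' & Hi & Hs & ->) (j & t' & Hj & Ht & ->).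
    apply compatible_links. intros x y z H. apply S, in_reduce. right.
    exists i, j. split; auto. split; auto. apply in_pair_constrs. eauto 9. }
  assert (R : nr (col 0) (col 1) (col 2) = false).
  { apply (surjective_rainbow _ _ _ T (conj TV TC)). intros d.
    destruct (Sur d) as (v & Hv & <-).
    destruct (vertex_cover (nvars I) v ltac:(lia) Hv) as (m & s & Hm & Hs & M).
    exists (map3 col s). split; auto. now exists m, s. }
  (* Truth is read off the first vertex of the triple; the constants being rainbow, the colours of
     vertices 0 and 1 differ. *)
  set (alpha := fun v => eqb3 (col (vx v)) (col 1)).
  assert (A : forall v, v < nvars I ->
    col (vx v) = xcol (col 0) (col 1) (col 2) (alpha v) /\
    col (vz v) = zcol (col 0) (col 1) (col 2) (alpha v) /\
    col (vw v) = wcol (col 0) (col 1) (col 2) (alpha v)).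
  { intros v Hv.
    destruct (rainbow_value _ _ _ T (col (vx v), col (vz v), col (vw v)) (conj TV TC) R) as [b E].
    { exists (Datatypes.S v), (vx v, vz v, vw v). split; [lia|]. split; [|reflexivity].
      unfold vertices, family. cbn [In]. auto 6. }
    injection E as Ex Ez Ew.
    assert (Eb : alpha v = b).
    { unfold alpha. rewrite Ex. revert R. destruct b; cbn.
      - intros _. apply eqb3_spec. reflexivity.
      - unfold nr. now destruct (eqb3 (col 0) (col 1)). }
    rewrite Eb. auto. }
  exists alpha. intros c Hc.
  assert (Hr : In (translate c) (constrs (reduce I))) by (apply in_reduce; eauto).
  apply S in Hr. change (sat_constr col (translate c)) in Hr.
  destruct (W c Hc) as (R' & HR & _ & Hv). exists R'. split; auto.
  apply wf_in_Gamma0 in W. rewrite Forall_forall in W.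
  assert (Ax := fun v H => proj1 (A v H)).
  assert (Az := fun v H => proj1 (proj2 (A v H))).
  assert (Aw := fun v H => proj2 (proj2 (A v H))).
  destruct (W c Hc) as [a b d|a b d|a|a]; injection HR as <-; cbn [translate] in Hr;
    apply sat_constr_N in Hr; cbn in Hv; cbn.
  - rewrite !Ax, Az in Hr by auto. now apply nr_value_xz in Hr.
  - rewrite !Ax, Aw in Hr by auto. now apply nr_value_xw in Hr.
  - rewrite !Ax in Hr by auto. now apply nr_value_false in Hr.
  - rewrite !Ax in Hr by auto. now apply nr_value_true in Hr.
Qed.

Lemma reduce_correct I : Forall in_Gamma0 (constrs I) ->
  CSP Gamma0 (enc_instance I) <-> SCSP LangN (enc_instance (reduce I)).
Proof.
  intros G. split.
  - intros (I' & E & W & alpha & S). apply enc_instance_inj in E as <-.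
    exists (reduce I). split; auto. split; [now apply reduce_wf|].
    exists (colouring alpha). split; [now apply reduce_complete|].
    (* The constant vertices already show all three colours. *)
    intros d. exists (match d with t0 => 0 | t1 => 1 | t2 => 2 end).
    cbn [reduce nvars]. split; [destruct d; lia|now destruct d].
  - intros (J & E & W & col & S & Sur). apply enc_instance_inj in E as <-.
    apply (reduce_wf_inv I G) in W.
    exists I. split; auto. split; auto. now apply (reduce_sound I col).
Qed.

(** * Running time and the polynomial-time reduction *)

Lemma reduction_spec x K : time_coeff * (length x + 1) ^ 3 + 2 <= K ->
  exists s, run (program reduction) K (init x) = Some s /\
    (CSP Gamma0 x <-> SCSP LangN (regs s 1)).
Proof.
  intros L. change (init x) with (MState 0 (regs (init x))).
  destruct (reduction_correct x) as [(I & s & G & -> & R & E)|(s & R & F)].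
  - destruct (program_run _ _ _ _ _ _ R ltac:(discriminate) L) as (q & Eq).
    eexists. split; [exact Eq|]. cbn [regs]. rewrite E. now apply reduce_correct.
  - destruct (program_run _ _ _ _ _ _ R ltac:(discriminate) L) as (q & Eq).
    eexists. split; [exact Eq|]. cbn [regs]. rewrite upd_same. split.
    + intros (I & -> & W & _). apply wf_in_Gamma0 in W. now destruct (F I W).
    (* A leading [false] encodes zero variables. *)
    + intros ([[|n] cs] & E & _ & col & _ & Sur); [|discriminate].
      destruct (Sur t0) as (v & Hv & _). cbn in Hv. lia.
Qed.

(** Brings the bound into the form demanded by [poly_time_computable]: for positive [n] one has
    [n + 1 <= 2 * n], and the additive constant covers [n = 0]. *)
Lemma cube_bound c n : c * (n + 1) ^ 3 + 2 <= (8 * c + 2) * n ^ 3 + (8 * c + 2).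
Proof.
  assert (H : (n + 1) ^ 3 <= 8 * n ^ 3 + 8) by (cbn [Nat.pow]; nia).
  apply (Nat.mul_le_mono_l _ _ c) in H. lia.
Qed.

Theorem theorem3p1 : poly_reducible (CSP Gamma0) (SCSP LangN).
Proof.
  pose proof reduction_spec as H. pose proof (cube_bound time_coeff) as Hc.
  revert H Hc. generalize time_coeff (program reduction). intros c p H Hc.
  assert (Hx := fun x => H x _ (Hc (length x))).
  (* The reduction is read off the run of the machine; the default [[]] never arises, because the
     machine halts within this number of steps. *)
  exists (fun x => match run p ((8 * c + 2) * length x ^ 3 + (8 * c + 2)) (init x) with
                   | Some s => regs s 1 | None => [] end).
  split.
  - exists p, (8 * c + 2), 3. intros x. destruct (Hx x) as (s & E & _).
    exists s. now rewrite E.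
  - intros x. destruct (Hx x) as (s & E & C). now rewrite E.
Qed.
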